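(* Let $u=(u^1,\dots,u^m):\mathbb{R}^n\to\mathbb{R}^m$ be a smooth vector-valued function such that $M=\operatorname{graph} u=\{(x,u(x)):x\in\mathbb{R}^n\}\subset\mathbb{R}^{n+m}$ is a self-shrinker. If the slope of $u$ satisfies $$\Delta_u:=\det\Big(\delta_{ij}+\sum_{\alpha=1}^m u_i^\alpha u_j^\alpha\Big)^{1/2}<3$$ at every point of $\mathbb{R}^n$, then $u$ is linear and $M$ is a linear subspace of $\mathbb{R}^{n+m}$.
   Context: Here $u_i^\alpha=\partial u^\alpha/\partial x_i$, and the determinant is that of the $n\times n$ matrix with indices $1\le i,j\le n$. A self-shrinker is a submanifold of $\mathbb{R}^{n+m}$ with position vector $X$ satisfying $H=-\frac12X^N$, where $X^N$ is the orthogonal projection of $X$ onto the normal bundle and the mean curvature vector $H$ is the trace of the second fundamental form $B_{VW}=(\overline\nabla_VW)^N$ with respect to the induced metric (no factor $1/n$; $\overline\nabla$ is the flat connection). *)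

(* Defs.v *)
From HB Require Import structures.
From mathcomp Require Import all_boot all_order all_algebra.
From mathcomp Require Import all_classical all_reals all_analysis.
Set Implicit Arguments.
Unset Strict Implicit.
Unset Printing Implicit Defensive.
Import Order.TTheory GRing.Theory Num.Theory.
Import numFieldNormedType.Exports.
Local Open Scope classical_set_scope.
Local Open Scope ring_scope.

Definition partial (R : realType) (n k : nat) (i : 'I_n)
    (f : 'rV[R]_n -> 'rV[R]_k) (x : 'rV[R]_n) : 'rV[R]_k :=
  'D_(delta_mx 0 i) f x.

Definition iter_partial (R : realType) (n k : nat) (s : seq 'I_n)
    (f : 'rV[R]_n -> 'rV[R]_k) : 'rV[R]_n -> 'rV[R]_k :=
  foldr (@partial R n k) f s.

(* C^oo: all iterated partial derivatives exist and are continuous. The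
   [derivable] clause is needed because 'D_v is total. *)
Definition smooth (R : realType) (n k : nat) (f : 'rV[R]_n -> 'rV[R]_k) : Prop :=
  forall s : seq 'I_n,
    continuous (iter_partial s f) /\
    forall (i : 'I_n) (x : 'rV[R]_n),
      derivable (iter_partial s f) x (delta_mx 0 i).

(* A submanifold of R^N is given here by a global parametrization
   F : R^n -> R^N. The rows of [tangent_frame F x] are the coordinate vectors
   dF(e_i), a basis of the tangent space at F x when F is an immersion. *)
Definition tangent_frame (R : realType) (n N : nat)
    (F : 'rV[R]_n -> 'rV[R]_N) (x : 'rV[R]_n) : 'M[R]_(n, N) :=
  \matrix_(i < n) partial i F x.

Definition immersion (R : realType) (n N : nat)
    (F : 'rV[R]_n -> 'rV[R]_N) : Prop :=
  smooth F /\ forall x : 'rV[R]_n, row_free (tangent_frame F x).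

(* g_ij = <dF(e_i), dF(e_j)> *)
Definition induced_metric (R : realType) (n N : nat)
    (F : 'rV[R]_n -> 'rV[R]_N) (x : 'rV[R]_n) : 'M[R]_n :=
  tangent_frame F x *m (tangent_frame F x)^T.

(* v^N: the kernel of the transposed frame is the Euclidean orthogonal
   complement of the tangent space, onto which v is projected along the
   tangent space. *)
Definition normal_part (R : realType) (n N : nat)
    (F : 'rV[R]_n -> 'rV[R]_N) (x : 'rV[R]_n) (v : 'rV[R]_N) : 'rV[R]_N :=
  v *m proj_mx (kermx (tangent_frame F x)^T) <<tangent_frame F x>>%MS.

(* B_{VW} = (nabla_V W)^N for the coordinate fields V = dF(e_i), W = dF(e_j):
   the flat derivative along V of the field W is the partial derivative in the
   direction i of x |-> dF_x(e_j). *)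
Definition second_fundamental_form (R : realType) (n N : nat)
    (F : 'rV[R]_n -> 'rV[R]_N) (x : 'rV[R]_n) (i j : 'I_n) : 'rV[R]_N :=
  normal_part F x (partial i (partial j F) x).

(* The trace g^{ij} B_ij, without a factor 1/n. *)
Definition mean_curvature (R : realType) (n N : nat)
    (F : 'rV[R]_n -> 'rV[R]_N) (x : 'rV[R]_n) : 'rV[R]_N :=
  \sum_(i < n) \sum_(j < n)
    invmx (induced_metric F x) i j *: second_fundamental_form F x i j.

Definition self_shrinker (R : realType) (n N : nat)
    (F : 'rV[R]_n -> 'rV[R]_N) : Prop :=
  immersion F /\
  forall x : 'rV[R]_n, mean_curvature F x = - (2^-1 *: normal_part F x (F x)).

Definition graph_map (R : realType) (n m : nat)
    (u : 'rV[R]_n -> 'rV[R]_m) (x : 'rV[R]_n) : 'rV[R]_(n + m) :=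
  row_mx x (u x).

Definition slope (R : realType) (n m : nat)
    (u : 'rV[R]_n -> 'rV[R]_m) (x : 'rV[R]_n) : R :=
  Num.sqrt (\det (\matrix_(i < n, j < n)
    ((i == j)%:R + \sum_(a < m) partial i u x 0 a * partial j u x 0 a))).

Definition linear_subspace (R : realType) (N : nat) (M : set 'rV[R]_N) : Prop :=
  exists U : {vspace 'rV[R]_N}, M = [set X | X \in U].

(* Main.v *)
Require Import Defs.
From HB Require Import structures.
From mathcomp Require Import all_boot all_order all_algebra.
From mathcomp Require Import all_classical all_reals all_analysis.
From mathcomp Require Import perm ring lra.
Import Order.TTheory GRing.Theory Num.Theory.
Import numFieldNormedType.Exports.
Local Open Scope classical_set_scope.
Local Open Scope ring_scope.

(* The self-shrinker equation of the graph of u reads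
   G^ij u_ij = (x.Du - u) / 2, where G is the inverse of the induced metric
   g = 1 + Du Du^T, so that the drift Laplacian of the graph is
   L f = G^ij f_ij - x.Df / 2 in the coordinates x.

   The function det g, the square of the slope, is a bounded subsolution of L:
   in a frame adapted to the singular values l_i of Du, the quotient of
   L (det g) by 2 det g is a quadratic form in the second derivatives of u, with
   coefficients depending on the l_i, and this form is positive definite as long
   as prod (1 + l_i^2) < 9.

   Since G <= 1, we have L |x|^2 <= 2n - |x|^2, so a bounded subsolution attains
   its maximum, and it is constant by the strong maximum principle.  Then
   L (det g) = 0, which forces D^2 u = 0, and the equation becomes u = x.Du with
   Du constant. *)

Set Implicit Arguments.
Unset Strict Implicit.
Unset Printing Implicit Defensive.

(** * The quadratic form of the second derivatives *)

(** The bound 9 is [(1 + 2)^2]. For three distinct indices the form contains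
    [x^2 + y^2 + l1 l2 x y], which is nonnegative only for [|l1 l2| <= 2]; since
    [(1 + l1^2) (1 + l2^2) >= (1 + |l1 l2|)^2], the product bound keeps every pair in this range.
    With a repeated index, a diagonal coefficient can be negative even below the bound, and the
    square of the trace has to compensate for it. This is why [det g] is used and not its logarithm:
    the gradient term produced by the logarithm would cancel exactly the squared trace.

    A frame adapted to the singular values need not vary continuously, so one frame is frozen at
    each point and only derivatives along constant vectors are taken. Third derivatives of [u] do
    appear in [L (det g)]; the self-shrinker equation, differentiated once, turns them into products
    of first and second derivatives. *)

Lemma sum_cauchy_schwarz (R : realFieldType) (I : finType) (P : pred I) (x y : I -> R) :
  (\sum_(i | P i) x i * y i) ^+ 2 <=
  (\sum_(i | P i) x i ^+ 2) * (\sum_(i | P i) y i ^+ 2).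
Proof.
set X := \sum_(i | P i) x i ^+ 2; set Y := \sum_(i | P i) y i ^+ 2.
set Z := \sum_(i | P i) x i * y i.
have X0 : 0 <= X by apply: sumr_ge0 => i _; exact: sqr_ge0.
have H : 0 <= X * (X * Y - Z ^+ 2).
  have -> : X * (X * Y - Z ^+ 2) = \sum_(i | P i) (X * y i - Z * x i) ^+ 2.
    rewrite (eq_bigr (fun i => X ^+ 2 * y i ^+ 2 - 2 * X * Z * (x i * y i)
      + Z ^+ 2 * x i ^+ 2)) => [|i _]; last by ring.
    by rewrite big_split sumrB /= -!mulr_sumr -/X -/Y -/Z; ring.
  by apply: sumr_ge0 => i _; exact: sqr_ge0.
have [X0'|X0'] := ltrP 0 X.
  by rewrite -subr_ge0 -(pmulr_rge0 _ X0').
have XE : X = 0 by lra.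
have xi0 i : P i -> x i = 0.
  by move=> Pi; move/eqP: XE; rewrite psumr_eq0 => [|j _]; rewrite ?sqr_ge0//;
    move/allP/(_ i (mem_index_enum _))/implyP/(_ Pi); rewrite sqrf_eq0 => /eqP.
rewrite XE mul0r /Z big1 ?expr0n// => i Pi; by rewrite xi0// mul0r.
Qed.

Lemma ler_prod1D_sum (R : realDomainType) (I : finType) (P : pred I) (s : I -> R) :
  (forall i, 0 <= s i) -> 1 + \sum_(i | P i) s i <= \prod_(i | P i) (1 + s i).
Proof.
(* Nonnegativity of the sums is carried along: it controls the cross term when two bounds are
   multiplied. *)
move=> s0; suff [] : 1 + \sum_(i | P i) s i <= \prod_(i | P i) (1 + s i) /\
  0 <= \sum_(i | P i) s i by [].
elim/big_ind2: _ => [|x y z t [xy x0] [zt z0]|i _]; [|split; nra|by split].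
by rewrite addr0.
Qed.

Section cyclic.
Variable R : realFieldType.
Implicit Types x y z l : R.

(** Completing the square in [x] leaves a form in [y] and [z], which splits into nonnegative terms
    when [2 < l1^2] and [l1^2 (l2^2 + l3^2) <= 4]. The latter follows from the product bound: with
    [p = a (b + c)], the means inequality gives [(1 + a) (1 + b + c) >= (1 + sqrt p)^2], which
    exceeds 9 for [p > 4]. *)
Lemma cyclic_form_ge0_aux x y z (l1 l2 l3 : R) : 2 < l1 ^+ 2 ->
  (1 + l1 ^+ 2) * (1 + l2 ^+ 2) * (1 + l3 ^+ 2) <= 9 ->
  0 <= x ^+ 2 + y ^+ 2 + z ^+ 2 + l1 * l2 * (x * y) + l2 * l3 * (y * z)
       + l3 * l1 * (z * x).
Proof.
move=> a2 H.
have b0 := sqr_ge0 l2; have c0 := sqr_ge0 l3.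
set a := l1 ^+ 2 in a2 H *; set b := l2 ^+ 2 in H b0 *; set c := l3 ^+ 2 in H c0 *.
have bc : 0 <= b * c by exact: mulr_ge0.
have H2 : (1 + a) * (1 + (b + c)) <= 9 by nra.
have H3 : a * (b + c) <= 4.
  by rewrite leNgt; apply/negP => H4; have := sqr_ge0 (a - (b + c)); nra.
have -> : x ^+ 2 + y ^+ 2 + z ^+ 2 + l1 * l2 * (x * y) + l2 * l3 * (y * z)
       + l3 * l1 * (z * x) = (x + l1 / 2 * (l2 * y + l3 * z)) ^+ 2 +
   ((1 - a * (b + c) / 4) * (y ^+ 2 + z ^+ 2) +
    (a - 2) / 4 * (l2 * z - l3 * y) ^+ 2 + c / 2 * y ^+ 2 + b / 2 * z ^+ 2).
  by rewrite /a /b /c; field.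
have ? := sqr_ge0 y; have ? := sqr_ge0 z.
apply: addr_ge0; first exact: sqr_ge0.
apply: addr_ge0; last by apply: mulr_ge0 => //; lra.
apply: addr_ge0; last by apply: mulr_ge0 => //; lra.
by apply: addr_ge0; apply: mulr_ge0; rewrite ?sqr_ge0//; lra.
Qed.

(** If no square exceeds 2, half the square of [l1 x + l2 y + l3 z] supplies all mixed terms and
    leaves the diagonal coefficients [1 - li^2 / 2 >= 0]. Otherwise cyclic symmetry moves the large
    one to the first place. *)
Lemma cyclic_form_ge0 x y z (l1 l2 l3 : R) :
  (1 + l1 ^+ 2) * (1 + l2 ^+ 2) * (1 + l3 ^+ 2) <= 9 ->
  0 <= x ^+ 2 + y ^+ 2 + z ^+ 2 + l1 * l2 * (x * y) + l2 * l3 * (y * z)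
       + l3 * l1 * (z * x).
Proof.
move=> H.
have [a2|a2] := ltrP 2 (l1 ^+ 2); first exact: cyclic_form_ge0_aux.
have [b2|b2] := ltrP 2 (l2 ^+ 2).
  have := @cyclic_form_ge0_aux y z x l2 l3 l1 b2.
  rewrite [_ * _ * _](_ : _ = (1 + l1 ^+ 2) * (1 + l2 ^+ 2) * (1 + l3 ^+ 2)); last by ring.
  move=> /(_ H).
  by congr (_ <= _); ring.
have [c2|c2] := ltrP 2 (l3 ^+ 2).
  have := @cyclic_form_ge0_aux z x y l3 l1 l2 c2.
  rewrite [_ * _ * _](_ : _ = (1 + l1 ^+ 2) * (1 + l2 ^+ 2) * (1 + l3 ^+ 2)); last by ring.
  move=> /(_ H).
  by congr (_ <= _); ring.
have -> : x ^+ 2 + y ^+ 2 + z ^+ 2 + l1 * l2 * (x * y) + l2 * l3 * (y * z)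
       + l3 * l1 * (z * x) = (1 - l1 ^+ 2 / 2) * x ^+ 2 + (1 - l2 ^+ 2 / 2) * y ^+ 2
  + (1 - l3 ^+ 2 / 2) * z ^+ 2 + (l1 * x + l2 * y + l3 * z) ^+ 2 / 2 by field.
have ? := sqr_ge0 x; have ? := sqr_ge0 y; have ? := sqr_ge0 z.
have ? := sqr_ge0 (l1 * x + l2 * y + l3 * z).
by repeat (apply: addr_ge0); try (apply: mulr_ge0 => //; lra).
Qed.

(** This is the case of a negative coefficient [2 + s - s t], that is [t + 1 < (1 + s) (t - 1)].
    Inserted in the product bound it gives [(t + 1)^2 (1 + r) <= 9 (t - 1)]; hence
    [(t - 2) (t - 5) <= 0], and [(t + 1)^2 >= 8 (t - 1)] gives [1 + r <= 9 / 8]. The constant 52/100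
    is just above [9 - 6 sqrt 2], where the final quadratic in [t] would get a double root. *)
Lemma large_pair_bounds (s t r : R) : 0 <= s -> 0 <= t -> 0 <= r ->
  2 + s < s * t -> (1 + t) * (1 + s) * (1 + r) <= 9 ->
  [/\ t <= 5, r <= 1 / 8 & s * t - 2 - s <= 52 / 100 * s].
Proof.
move=> s0 t0 r0 st H.
have t1 : 1 < t.
  by rewrite ltNge; apply/negP => H1; have := ler_wpM2l s0 H1; lra.
have K1 : (t + 1) < (1 + s) * (t - 1) by lra.
have K2 : (t + 1) ^+ 2 * (1 + r) <= 9 * (t - 1).
  have h1 : 0 <= (1 + t) * (1 + r) by apply: mulr_ge0; lra.
  have h2 := ler_wpM2l h1 (ltW K1).
  have h3 : 0 <= t - 1 by lra.
  have h4 := ler_wpM2r h3 H.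
  by lra.
have K3 : (t + 1) ^+ 2 <= 9 * (t - 1).
  by have := mulr_ge0 (sqr_ge0 (t + 1)) r0; lra.
have t5 : t <= 5 by rewrite leNgt; apply/negP => H1; nra.
split => //.
  rewrite leNgt; apply/negP => H1.
  have : 0 < (t + 1) ^+ 2 * (r - 1 / 8) by apply: mulr_gt0; [apply: exprn_gt0|]; lra.
  by have := sqr_ge0 (t - 3); lra.
have K4 : (1 + t) * (1 + s) <= 9.
  have : 0 <= (1 + t) * (1 + s) * r by rewrite !mulr_ge0//; lra.
  lra.
have t8 : 0 < 8 - t by lra.
rewrite -subr_ge0 -(pmulr_rge0 _ t8).
have : 0 <= s * (100 * t ^+ 2 - 752 * t + 1416).
  apply: mulr_ge0; first by [].
  have -> : 100 * t ^+ 2 - 752 * t + 1416 = (10 * t - 376 / 10) ^+ 2 + 224/100 by field.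
  by have := sqr_ge0 (10 * t - 376/10); lra.
lra.
Qed.

(** Weighted Cauchy-Schwarz, since [1/2 + 10/12 + 1/12 < 100/52]. The weights are what the form
    offers: 2 is the coefficient of the squared trace, 12/10 is a lower bound of [(1 + t) / t] for
    [t <= 5], and 12 is 3/2 divided by the bound 1/8 of [r]. *)
Lemma young3 (u v z : R) :
  52 / 100 * (u - v - z) ^+ 2 <= 2 * u ^+ 2 + 12 / 10 * v ^+ 2 + 12 * z ^+ 2.
Proof.
have := sqr_ge0 (u + 13 / 37 * (v + z)); have := sqr_ge0 (v - 65 / 46 * z).
have := sqr_ge0 z; lra.
Qed.

End cyclic.

Section repeated_index.
Variables (R : realFieldType) (I : finType) (l a : I -> R) (k : I).
Hypothesis prod9 : \prod_i (1 + l i ^+ 2) <= 9.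

Let s i := l i ^+ 2.
Let s0 i : 0 <= s i. Proof. exact: sqr_ge0. Qed.

(** If the coefficient at some [i] is negative, the product bound makes all singular values other
    than those at [i] and [k] small. Then [l i * a i] is the full sum minus the [k] term and a small
    rest, so [young3] absorbs the negative term into the squared sum, the [a k] term and the other
    diagonal terms. *)
Lemma repeated_index_form_ge0 : 0 <= (1 + s k) * a k ^+ 2
  + \sum_(i | i != k) (2 + s i - s i * s k) * a i ^+ 2
  + 2 * (\sum_i l i * a i) ^+ 2.
Proof.
have [/existsP[i /andP[ik Di]]|] :=
    boolP [exists i, (i != k) && (2 + s i < s i * s k)]; last first.
  rewrite negb_exists => /forallP H; apply: addr_ge0; last by rewrite mulr_ge0 ?sqr_ge0.
  apply: addr_ge0; first by rewrite mulr_ge0 ?sqr_ge0 ?addr_ge0 ?s0.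
  apply: sumr_ge0 => i ik; rewrite mulr_ge0 ?sqr_ge0//.
  by have := H i; rewrite ik /= -leNgt subr_ge0.
pose P j := (j != k) && (j != i).
pose r := \sum_(j | P j) s j.
pose N := \sum_(j | P j) a j ^+ 2.
pose Z := \sum_(j | P j) l j * a j.
have r0 : 0 <= r by apply: sumr_ge0.
have N0 : 0 <= N by apply: sumr_ge0 => j _; exact: sqr_ge0.
have ZN : Z ^+ 2 <= r * N by exact: sum_cauchy_schwarz.
have prod3 : (1 + s k) * (1 + s i) * (1 + r) <= 9.
  apply: le_trans prod9; rewrite (bigD1 k)//= (bigD1 i)//= mulrA.
  by apply: ler_wpM2l; [rewrite mulr_ge0 ?addr_ge0 ?s0|exact: ler_prod1D_sum].
have [t5 r8 si] := large_pair_bounds (s0 i) (s0 k) r0 Di prod3.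
have -> : \sum_i l i * a i = l k * a k + l i * a i + Z.
  by rewrite (bigD1 k)//= (bigD1 i)//= addrA.
rewrite (bigD1 i)//=.
(* As [s k <= 5] and [s j <= r <= 1/8], each coefficient is at least [2 - 4 / 8]. *)
have DN : 3 / 2 * N <= \sum_(j | P j) (2 + s j - s j * s k) * a j ^+ 2.
  rewrite mulr_sumr; apply: ler_sum => j Pj; apply: ler_wpM2r; first exact: sqr_ge0.
  have sj : s j <= r by rewrite /r (bigD1 j)//= lerDl sumr_ge0.
  have := s0 j; have := s0 k; nra.
have := young3 (l k * a k + l i * a i + Z) (l k * a k) Z.
rewrite (_ : _ - _ - Z = l i * a i); last by ring.
have ai : (s i * s k - 2 - s i) * a i ^+ 2 <= 52 / 100 * (l i * a i) ^+ 2.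
  rewrite exprMn [leRHS]mulrA.
  by apply: ler_wpM2r => //; exact: sqr_ge0.
have ak : 12 / 10 * (l k * a k) ^+ 2 <= (1 + s k) * a k ^+ 2.
  rewrite exprMn [leLHS]mulrA; apply: ler_wpM2r; [exact: sqr_ge0|rewrite -/(s k); lra].
have Z12 : 12 * Z ^+ 2 <= 3 / 2 * N.
  have := ler_wpM2r N0 r8; lra.
move: DN; set DS := \sum_(_ | _) _ => DN.
set U := (_ + Z) ^+ 2.
lra.
Qed.

End repeated_index.

Section triple_sum.
Variables (R : realFieldType) (I : finType).
Implicit Types F : I -> I -> I -> R.

Lemma sum3_rot F : \sum_i \sum_j \sum_k F j k i = \sum_i \sum_j \sum_k F i j k.
Proof.
rewrite exchange_big /=; apply: eq_bigr => j _; exact: exchange_big.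
Qed.

Lemma sum3_split F : \sum_i \sum_j \sum_k F i j k =
  \sum_k (F k k k + \sum_(i | i != k) (F i i k + F i k i + F k i i))
  + \sum_i \sum_j \sum_k (if [&& j != i, k != i & k != j] then F i j k else 0).
Proof.
have step i : \sum_j \sum_k F i j k = F i i i + \sum_(k | k != i) F i i k
   + (\sum_(j | j != i) F i j i + \sum_(j | j != i) F i j j)
   + \sum_j \sum_k (if [&& j != i, k != i & k != j] then F i j k else 0).
  rewrite [X in _ = _ + X](bigD1 i)//= [X in _ = _ + (X + _)]big1 ?add0r => [|k _]; last first.
    by rewrite eqxx.
  rewrite (bigD1 i)//= (bigD1 i)//= -!addrA; congr (_ + (_ + _)).
  rewrite -!big_split /=; apply: eq_bigr => j ji.
  rewrite (bigD1 i)//= (bigD1 j)//=; congr (_ + (_ + _)).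
  rewrite ji /= -big_mkcond /=; exact: eq_bigr.
rewrite (eq_bigr _ (fun i _ => step i)) !big_split /=; congr (_ + _).
rewrite -!addrA; congr (_ + _).
under [in RHS]eq_bigr do rewrite !big_split /=.
rewrite !big_split /= -!addrA; congr (_ + (_ + _)).
  rewrite (exchange_big_dep xpredT)//=; apply: eq_bigr => k _.
  by apply: eq_bigl => i; rewrite eq_sym.
rewrite (exchange_big_dep xpredT)//=; apply: eq_bigr => k _.
by apply: eq_bigl => i; rewrite eq_sym.
Qed.

(* The terms with three distinct indices are grouped by cyclic rotation, the
   others by the index that does not occur twice. *)
Lemma cubic_form_ge0 (l : I -> R) (h : I -> I -> I -> R) :
  (forall i j k, h i j k = h i k j) -> \prod_i (1 + l i ^+ 2) <= 9 ->
  0 <= \sum_i \sum_j \sum_k (h i j k ^+ 2 + l i * l j * (h i j k * h j i k))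
       + 2 * \sum_k (\sum_i l i * h i i k) ^+ 2.
Proof.
move=> hC prod9; rewrite sum3_split -addrA addrC -addrA; apply: addr_ge0; last first.
  rewrite mulr_sumr -big_split /=; apply: sumr_ge0 => k _.
  pose a i := h i i k.
  have := @repeated_index_form_ge0 R I l a k prod9.
  set S := (\sum_i l i * h i i k); rewrite -/S.
  suff : \sum_(i | i != k) (2 + l i ^+ 2 - l i ^+ 2 * l k ^+ 2) * a i ^+ 2 <=
    \sum_(i | i != k)
     (h i i k ^+ 2 + l i * l i * (h i i k * h i i k) +
      (h i k i ^+ 2 + l i * l k * (h i k i * h k i i)) +
      (h k i i ^+ 2 + l k * l i * (h k i i * h i k i))).
    rewrite /a -/S; set DS := \sum_(i | _) ((_ - _) * _); set ES := \sum_(i | _) (_ + _ + _).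
    set hk := h k k k; lra.
  apply: ler_sum => i ik; rewrite (hC i k i) /a.
  (* The entry [h k i i] does not occur in the trace. Completing the square in it costs
     [l i ^+ 2 * l k ^+ 2 * u ^+ 2], the source of the negative coefficients. *)
  rewrite -subr_ge0; set u := h i i k; set v := h k i i.
  rewrite [leRHS](_ : _ = (v + l k * l i * u) ^+ 2); first exact: sqr_ge0.
  by ring.
pose E i j k := if [&& j != i, k != i & k != j] then
  h i j k ^+ 2 + l i * l j * (h i j k * h j i k) else 0.
rewrite -/(E _ _ _).
have : 0 <= \sum_i \sum_j \sum_k (E i j k + E j k i + E k i j).
  apply: sumr_ge0 => i _; apply: sumr_ge0 => j _; apply: sumr_ge0 => k _.
  rewrite /E ![i == _]eq_sym ![k == _]eq_sym.
  have [->|ji] := eqVneq j i; rewrite /= ?andbF /= ?addr0//.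
  have [->|ik] := eqVneq i k; rewrite /= ?andbF /= ?addr0//.
  have [->|jk] := eqVneq j k; rewrite /= ?andbF /= ?addr0//.
  rewrite (hC j i k) (hC k j i) (hC i k j).
  have : (1 + l i ^+ 2) * (1 + l j ^+ 2) * (1 + l k ^+ 2) <= 9.
    apply: le_trans prod9.
    rewrite (bigD1 i)//= (bigD1 j)//= (bigD1 k)//=; last first.
      by rewrite ![k == _]eq_sym jk ik.
    rewrite !mulrA -[leLHS]mulr1; apply: ler_wpM2l.
      by rewrite !mulr_ge0// addr_ge0// sqr_ge0.
    elim/big_ind: _ => // [x y x1 y1|m _]; first by rewrite -[1]mulr1 ler_pM.
    by rewrite lerDl sqr_ge0.
  move=> /(@cyclic_form_ge0 _ (h i j k) (h j k i) (h k i j)); congr (_ <= _); ring.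
under eq_bigr => i _ do under eq_bigr => j _ do rewrite !big_split /=.
under eq_bigr => i _ do rewrite !big_split /=.
rewrite !big_split /= (sum3_rot (fun i j k => E j k i)) (sum3_rot E).
set S := \sum_i _; lra.
Qed.

End triple_sum.

Section strict.
Variables (R : realFieldType) (I : finType).

(* All terms of the form except the first are quadratic in [l], so the slack in
   the bound on the product is used by scaling [l] up. *)
Lemma cubic_form_gt0 (l : I -> R) : \prod_i (1 + l i ^+ 2) < 9 ->
  exists2 d, 0 < d & forall h : I -> I -> I -> R,
  (forall i j k, h i j k = h i k j) ->
  d * \sum_i \sum_j \sum_k h i j k ^+ 2 <=
  \sum_i \sum_j \sum_k (h i j k ^+ 2 + l i * l j * (h i j k * h j i k))
       + 2 * \sum_k (\sum_i l i * h i i k) ^+ 2.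
Proof.
set p := \prod_i _ => p9.
have p0 : 0 <= p by apply: prodr_ge0 => i _; rewrite addr_ge0 ?sqr_ge0.
(* The slack [1 - p / 9] is shared among the factors: [q ^+ n >= p / 9] by Bernoulli, and
   [w ^+ 2 * q <= 1] gives [q * (1 + (w * l i) ^+ 2) <= 1 + l i ^+ 2], so the product for [w * l] is
   still at most 9. The successor in [n.+1] covers an empty index type. *)
pose n := #|I|; pose e := (1 - p / 9) / n.+1%:R.
have n0 : (0 : R) < n.+1%:R by rewrite ltr0n.
have e0 : 0 < e by rewrite divr_gt0//; lra.
have e1 : e <= 1.
  by rewrite /e ler_pdivrMr// mul1r (@le_trans _ _ 1)// ?ler1n//; lra.
pose q := 1 - e / 2.
have q0 : 0 < q by rewrite /q; lra.
have q1 : q <= 1 by rewrite /q; lra.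
pose w := 1 + e / 4.
have w1 : w ^+ 2 * q <= 1 by rewrite /w /q; have := e0; have := e1; nra.
have w0 : 0 < w by rewrite /w; lra.
have bern : p / 9 <= q ^+ n.
  have B k : 1 - k%:R * (e / 2) <= q ^+ k.
    elim: k => [|k IH]; first by rewrite mul0r subr0 expr0.
    rewrite exprS; have := ler_wpM2l (ltW q0) IH.
    have : 0 <= (k%:R : R) * e ^+ 2 by rewrite mulr_ge0 ?sqr_ge0.
    rewrite -[k.+1%:R]natr1; set K := k%:R; set Q := q ^+ k; rewrite /q; lra.
  apply: le_trans (B n).
  have : n%:R * e <= 1 - p / 9.
    rewrite /e mulrCA -[leRHS]mulr1; apply: ler_wpM2l; first lra.
    by rewrite ler_pdivrMr// mul1r ler_nat.
  have : 0 <= n%:R * e by rewrite mulr_ge0 // ltW.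
  set N := n%:R; lra.
(* The form at [w * l] is [w ^+ 2] times the form at [l] plus [1 - w ^+ 2] times the squared norm of
   [h]; it is nonnegative, and division by [w ^+ 2] gives this [d]. *)
exists (1 - (w ^+ 2)^-1).
  rewrite subr_gt0 invf_lt1 ?exprn_gt0//; rewrite /w; have := e0; nra.
move=> h hC.
have : \prod_i (1 + (w * l i) ^+ 2) <= 9.
  have : \prod_i (q * (1 + (w * l i) ^+ 2)) <= p.
    apply: ler_prod => i _; rewrite mulr_ge0 ?(ltW q0) ?addr_ge0 ?sqr_ge0//=.
    by rewrite exprMn; have := ler_wpM2r (sqr_ge0 (l i)) w1; lra.
  rewrite big_split /= prodr_const -/n => H.
  have qn : 0 < q ^+ n by rewrite exprn_gt0.
  rewrite -(ler_pM2l qn); apply: le_trans H _; lra.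
move=> /(@cubic_form_ge0 R I (fun i => w * l i) h hC).
rewrite (_ : \sum_i \sum_j \sum_k (h i j k ^+ 2 + _) =
  w ^+ 2 * (\sum_i \sum_j \sum_k (h i j k ^+ 2 + l i * l j * (h i j k * h j i k)))
  + (1 - w ^+ 2) * \sum_i \sum_j \sum_k h i j k ^+ 2); last first.
  rewrite !mulr_sumr -big_split; apply: eq_bigr => i _.
  rewrite !mulr_sumr -big_split; apply: eq_bigr => j _.
  rewrite !mulr_sumr -big_split; apply: eq_bigr => k _ /=; ring.
rewrite (_ : \sum_k (\sum_i w * l i * h i i k) ^+ 2 =
  w ^+ 2 * \sum_k (\sum_i l i * h i i k) ^+ 2); last first.
  rewrite mulr_sumr; apply: eq_bigr => k _; rewrite -exprMn mulr_sumr.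
  by congr (_ ^+ 2); apply: eq_bigr => i _; rewrite mulrA.
set S1 := \sum_i \sum_j \sum_k (_ + _); set S2 := \sum_k _; set S3 := \sum_i _ => H.
have w2 : 0 < w ^+ 2 by rewrite exprn_gt0.
rewrite -(ler_pM2l w2) mulrA mulrBr mulr1 mulfV ?gt_eqF//; lra.
Qed.

End strict.

(** * Second derivatives with values in [R^m] *)

Definition dot (R : pzSemiRingType) (m : nat) (x y : 'rV[R]_m) : R :=
  \sum_(a < m) x 0 a * y 0 a.

Section dot.
Variables (R : comPzRingType) (m : nat).
Implicit Types (x y z : 'rV[R]_m).

Lemma dotC x y : dot x y = dot y x.
Proof. by apply: eq_bigr => a _; rewrite mulrC. Qed.

Lemma dotDl x y z : dot (x + y) z = dot x z + dot y z.
Proof. by rewrite -big_split; apply: eq_bigr => a _; rewrite mxE mulrDl. Qed.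

Lemma dotZl c x z : dot (c *: x) z = c * dot x z.
Proof. by rewrite /dot mulr_sumr; apply: eq_bigr => a _; rewrite mxE mulrA. Qed.

Lemma dotBl x y z : dot (x - y) z = dot x z - dot y z.
Proof. by rewrite dotDl -scaleN1r dotZl mulN1r. Qed.

Lemma dot_suml (I : finType) (x : I -> 'rV[R]_m) z :
  dot (\sum_i x i) z = \sum_i dot (x i) z.
Proof.
rewrite /dot exchange_big /=; apply: eq_bigr => a _.
by rewrite summxE mulr_suml.
Qed.

Lemma dotE x y : (x *m y^T) 0 0 = dot x y.
Proof. by rewrite mxE; apply: eq_bigr => a _; rewrite mxE. Qed.

End dot.

Lemma dot_ge0 (R : realDomainType) m (x : 'rV[R]_m) : 0 <= dot x x.
Proof. by apply: sumr_ge0 => a _; rewrite -expr2 sqr_ge0. Qed.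

Lemma dot_eq0 (R : realDomainType) m (x : 'rV[R]_m) : (dot x x == 0) = (x == 0).
Proof.
apply/idP/eqP => [|->]; last by rewrite /dot big1// => a _; rewrite mxE mul0r.
rewrite psumr_eq0 => [/allP H|a _]; last by rewrite -expr2 sqr_ge0.
apply/rowP => a; rewrite mxE; apply/eqP.
by have := H a (mem_index_enum _); rewrite mulf_eq0 orbb.
Qed.

Section tensor.
Variables (R : realFieldType) (n m : nat).
Variables (c : 'I_n -> 'rV[R]_m) (l : 'I_n -> R).
Hypothesis c_orth : forall i j, i != j -> dot (c i) (c j) = 0.
Hypothesis c_norm : forall i, dot (c i) (c i) = l i ^+ 2 / (1 + l i ^+ 2).

(** When [l i] is nonzero, [c i] has squared length [l i ^+ 2 / (1 + l i ^+ 2)], so the summand is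
    the squared component of [t] along the unit vector of [c i], and this is Bessel's inequality.
    When [l i = 0], [c i] vanishes and so does the summand. *)
Lemma bessel (t : 'rV[R]_m) :
  \sum_i ((dot t (c i) / l i) ^+ 2 + dot t (c i) ^+ 2) <= dot t t.
Proof.
have l1 i : 1 + l i ^+ 2 != 0 by rewrite gt_eqF// ltr_wpDr// sqr_ge0.
(* [k i] is [dot t (c i) / dot (c i) (c i)], so [y] is the residue of the orthogonal projection of
   [t] onto the span of the [c i]. *)
pose k i := dot t (c i) * (1 + l i ^+ 2) / l i ^+ 2.
pose y := t - \sum_i k i *: c i.
have yc i : dot y (c i) * k i = 0.
  rewrite dotBl dot_suml (bigD1 i)//= big1 => [|j ji]; last first.
    by rewrite dotZl c_orth// mulr0.
  rewrite dotZl c_norm addr0 /k.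
  have [->|l0] := eqVneq (l i) 0; first by rewrite expr0n invr0 !mulr0.
  by field; rewrite l0 l1.
have yt : dot y y = dot t y.
  rewrite {1}/y dotBl dot_suml big1 ?subr0// => i _.
  by rewrite dotZl dotC mulrC yc.
have : 0 <= dot y y by exact: dot_ge0.
rewrite yt dotC /y dotBl subr_ge0; apply: le_trans; rewrite dot_suml.
apply: ler_sum => i _; rewrite dotZl dotC /k.
have [l0|l0] := eqVneq (l i) 0.
  have /eqP : dot (c i) (c i) = 0 by rewrite c_norm l0 expr0n mul0r.
  rewrite dot_eq0 => /eqP ->; suff -> : dot t 0 = 0 by rewrite !(mul0r, mulr0, expr0n) addr0.
  by rewrite /dot big1// => a _; rewrite mxE mulr0.
rewrite le_eqVlt; apply/orP; left; apply/eqP; field; rewrite ?l0 ?l1 //.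
Qed.

Hypothesis l9 : \prod_i (1 + l i ^+ 2) < 9.
Variable t : 'I_n -> 'I_n -> 'rV[R]_m.
Hypothesis tC : forall i j, t i j = t j i.

Let tau k i j := dot (t i j) (c k).

(** For [c] and [t] the first and second derivatives of [u] in a frame orthonormal for the metric,
    this is half of [L (det g) / det g]. The first two sums form the squared norm of the second
    fundamental form, because [tau k i j] is the tangential component of [(0, t i j)] along the
    [k]-th frame vector. *)
Definition second_variation : R :=
  \sum_i \sum_j dot (t i j) (t i j) - \sum_k \sum_i \sum_j tau k i j ^+ 2
  + \sum_i \sum_j \sum_k tau i j k * tau j i k
  + 2 * \sum_k (\sum_i tau i i k) ^+ 2.

(** With [tau k = l k * h k], [bessel] bounds the first two sums below by the squared norm of [h],
    and what remains is the form of [cubic_form_gt0]. A zero of the form forces [h = 0], hence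
    [tau = 0]. *)
Lemma second_variation_ge0 : 0 <= second_variation /\
  (second_variation = 0 -> forall i j, t i j = 0).
Proof.
have [d d0 Hd] := cubic_form_gt0 l9.
pose h k i j := tau k i j / l k.
have tauE k i j : tau k i j = l k * h k i j.
  rewrite /h /tau; have [l0|l0] := eqVneq (l k) 0; last by rewrite mulrC divfK.
  have /eqP : dot (c k) (c k) = 0 by rewrite c_norm l0 expr0n mul0r.
  rewrite dot_eq0 => /eqP ->.
  by rewrite /dot big1 ?mul0r ?mulr0// => a _; rewrite mxE mulr0.
have {}Hd := Hd h (fun i j k => congr1 (fun x => dot x (c i) / l i) (tC j k)).
have B : \sum_k \sum_i \sum_j h k i j ^+ 2 + \sum_k \sum_i \sum_j tau k i j ^+ 2
    <= \sum_i \sum_j dot (t i j) (t i j).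
  rewrite -big_split /=.
  under eq_bigr do rewrite -big_split /=.
  rewrite exchange_big /=; apply: ler_sum => i _.
  under eq_bigr do rewrite -big_split /=.
  rewrite exchange_big /=; apply: ler_sum => j _; exact: bessel.
have E1 : \sum_i \sum_j \sum_k (h i j k ^+ 2 + l i * l j * (h i j k * h j i k)) =
  \sum_i \sum_j \sum_k h i j k ^+ 2 + \sum_i \sum_j \sum_k tau i j k * tau j i k.
  rewrite -big_split; apply: eq_bigr => i _.
  rewrite -big_split; apply: eq_bigr => j _.
  rewrite -big_split; apply: eq_bigr => k _; rewrite !tauE /=; ring.
have E2 : \sum_k (\sum_i l i * h i i k) ^+ 2 = \sum_k (\sum_i tau i i k) ^+ 2.
  by apply: eq_bigr => k _; congr (_ ^+ 2); apply: eq_bigr => i _; rewrite tauE.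
rewrite E1 E2 in Hd.
have H0 : 0 <= \sum_k \sum_i \sum_j h k i j ^+ 2.
  by do 3 (apply: sumr_ge0 => ? _); exact: sqr_ge0.
have dH0 := mulr_ge0 (ltW d0) H0.
rewrite /second_variation.
move: Hd B dH0; set dH := d * _; set S1 := \sum_i \sum_j dot _ _.
set S2 := \sum_k \sum_i \sum_j tau _ _ _ ^+ 2.
set S3 := \sum_i \sum_j \sum_k (tau _ _ _ * tau _ _ _).
set S4 := \sum_k (\sum_i tau _ _ _) ^+ 2.
set S5 := \sum_k \sum_i \sum_j h _ _ _ ^+ 2 => Hd B dH0.
split=> [|E0]; first lra.
have dH_0 : dH = 0 by lra.
have S50 : S5 = 0.
  by move/eqP: dH_0; rewrite /dH mulf_eq0 gt_eqF//= => /eqP.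
have h0 k i j : h k i j = 0.
  apply/eqP; rewrite -sqrf_eq0.
  move/eqP: S50; rewrite /S5 psumr_eq0 => [/allP/(_ k (mem_index_enum _))|? _]; last first.
    by do 2 (apply: sumr_ge0 => ? _); exact: sqr_ge0.
  rewrite psumr_eq0 => [/allP/(_ i (mem_index_enum _))|? _]; last first.
    by apply: sumr_ge0 => ? _; exact: sqr_ge0.
  rewrite psumr_eq0 => [/allP/(_ j (mem_index_enum _))//|? _]; exact: sqr_ge0.
have S20 : S2 = 0.
  by do 3 (rewrite /S2 big1// => ? _); rewrite tauE h0 mulr0 expr0n.
(* [h = 0] says nothing about the components of [t] orthogonal to all [c k]; these vanish because
   [S1] is the only sum left in the form. *)
have : S1 = 0.
  have : 0 <= S1 by do 2 (apply: sumr_ge0 => ? _); exact: dot_ge0.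
  have : S3 = 0 by do 3 (rewrite /S3 big1// => ? _); rewrite tauE h0 mulr0 mul0r.
  have : S4 = 0.
    by rewrite /S4 big1// => ? _; rewrite big1 ?expr0n// => ? _; rewrite tauE h0 mulr0.
  lra.
move=> /eqP S10 i j.
apply/eqP; rewrite -dot_eq0.
move: S10; rewrite /S1 psumr_eq0 => [/allP/(_ i (mem_index_enum _))|? _]; last first.
  by apply: sumr_ge0 => ? _; exact: dot_ge0.
rewrite psumr_eq0 => [/allP/(_ j (mem_index_enum _))//|? _]; exact: dot_ge0.
Qed.

End tensor.

(** * Directional derivatives *)

Section directional.
Variables (R : realType) (V : normedModType R).
Implicit Types (f g : V -> R) (x y v w : V).

Lemma is_derive_line f x v (t : R) : derivable f (x + t *: v) v ->
  is_derive t 1 (fun s : R => f (x + s *: v)) ('D_v f (x + t *: v)).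
Proof.
have E : (fun h : R => h^-1 *: (((fun s => f (x + s *: v)) \o shift t) (h *: 1) -
    f (x + t *: v))) =
  (fun h : R => h^-1 *: ((f \o shift (x + t *: v)) (h *: v) - f (x + t *: v))).
  apply/funext => h /=; congr (_ *: (f _ - _)).
  by rewrite /shift/= [h *: 1]mulr1 scalerDl addrCA.
move=> fd; apply: DeriveDef; first by rewrite /derivable /= E.
by rewrite /derive /= E.
Qed.

Lemma is_derive_scale_dir f x v (c : R) : derivable f x v ->
  is_derive x (c *: v) f (c * 'D_v f x).
Proof.
move=> fd; pose phi (s : R) := f (x + s *: v).
have p0 : is_derive (0 : R) 1 phi ('D_v f x).
  have := @is_derive_line f x v 0; rewrite scale0r addr0; exact.
have cd : is_derive (0 : R) 1 (fun s : R => c * s) c.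
  apply: is_derive_eq; exact: mulr1.
have pc : is_derive (0 : R) 1 (phi \o (fun s : R => c * s)) (c * 'D_v f x).
  rewrite mulrC; apply: is_derive1_comp; by rewrite mulr0.
have E : (fun h : R => h^-1 *: ((f \o shift x) (h *: (c *: v)) - f x)) =
  (fun h : R => h^-1 *: (((phi \o (fun s : R => c * s)) \o shift 0) (h *: 1) -
    (phi \o (fun s : R => c * s)) 0)).
  apply/funext => h /=; rewrite /phi/= /shift/= mulr0 scale0r addr0 addr0.
  by rewrite [h%:A]mulr1 scalerA [c * h]mulrC [_ + x]addrC.
case: pc => pc1 pc2; apply: DeriveDef; first by rewrite /derivable /= E.
by rewrite /derive /= E.
Qed.

Lemma MVT_line_lt f x w : (forall y, derivable f y w) ->
  exists2 c : R, 0 < c < 1 & f (x + w) - f x = 'D_w f (x + c *: w).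
Proof.
move=> fd; pose phi (s : R) := f (x + s *: w).
have dphi (s : R) : is_derive s 1 phi ('D_w f (x + s *: w)) by exact: is_derive_line.
have cphi : continuous phi.
  move=> s; apply: differentiable_continuous; apply/derivable1_diffP.
  by case: (dphi s).
have [|c c01] := @MVT R phi _ 0 1 ltr01 (fun s _ => dphi s).
  exact: continuous_subspaceT.
rewrite subr0 mulr1 /phi scale1r scale0r addr0 => H.
by exists c => //; move: c01; rewrite in_itv.
Qed.

Lemma MVT_line f x w : (forall y, derivable f y w) ->
  exists2 c : R, 0 <= c <= 1 & f (x + w) - f x = 'D_w f (x + c *: w).
Proof.
by move=> /(MVT_line_lt x)[c /andP[c0 c1] E]; exists c => //; rewrite !ltW.
Qed.

(* The increment along [w] starts at the moving point [x + h v], which is where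
   the continuity of ['D_w f] is needed. *)
Lemma is_derive_add_dir f x v w : derivable f x v ->
  (forall y, derivable f y w) -> {for x, continuous ('D_w f)} ->
  is_derive x (v + w) f ('D_v f x + 'D_w f x).
Proof.
move=> fv fw fc.
suff H : h^-1 *: ((f \o shift x) (h *: (v + w)) - f x) @[h --> 0^'] -->
    'D_v f x + 'D_w f x.
  apply: DeriveDef; first by apply/cvg_ex; eexists; exact: H.
  exact: cvg_lim H.
rewrite (_ : (fun h => _) = (fun h => h^-1 *: ((f \o shift x) (h *: v) - f x)) +
  (fun h => h^-1 *: (f (h *: v + x + h *: w) - f (h *: v + x)))); last first.
  apply/funext => h /=; transitivity (h^-1 *: (f (h *: v + x) - f x) +
    h^-1 *: (f (h *: v + x + h *: w) - f (h *: v + x))); last by [].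
  by rewrite -scalerDr /shift /= [h *: (v + w)]scalerDr [h *: v + _ + x]addrAC; congr (_ *: _); ring.
apply: cvgD; first exact: fv.
apply/cvgrPdist_le => /= e e0.
move/cvgrPdist_le : fc => /(_ e e0) /nbhs_ballP[d /= d0 dP].
have N0 : 0 < `|v| + `|w| + 1 by rewrite ltr_wpDl.
near=> h.
have h0 : h != 0 by near: h; exact: nbhs_dnbhs_neq.
have [c /andP[c0 c1] Ec] := @MVT_line f (h *: v + x) (h *: w)
  (fun y => @ex_derive _ _ _ _ _ _ _ (is_derive_scale_dir h (fw y))).
rewrite Ec (@derive_val _ _ _ _ _ _ _ (is_derive_scale_dir h (fw _))).
rewrite [_ *: _]mulrA mulVf// mul1r; apply: dP.
rewrite -ball_normE /= [h *: v + x]addrC -addrA opprD addrA subrr add0r.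
rewrite normrN.
apply: (@le_lt_trans _ _ (`|h| * (`|v| + `|w| + 1))).
  rewrite (le_trans (ler_normD _ _))// !normrZ (ger0_norm c0).
  rewrite !mulrDr -[leLHS]addr0 lerD ?mulr_ge0//.
  by rewrite lerD2l ler_piMl// mulr_ge0.
rewrite -ltr_pdivlMr//.
near: h; apply: dnbhs0_lt; exact: divr_gt0.
Unshelve. all: by end_near. Qed.

Lemma derive_sum_dir f (I : Type) (r : seq I) (v : I -> V) :
  (forall i y, derivable f y (v i)) -> (forall i, continuous ('D_(v i) f)) ->
  forall x, is_derive x (\sum_(i <- r) v i) f (\sum_(i <- r) 'D_(v i) f x).
Proof.
move=> fd fc; elim: r => [|i r IH] x.
  by rewrite !big_nil; exact: is_derive0.
rewrite !big_cons addrC [X in is_derive _ _ _ X]addrC.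
have /@derive_val <- := IH x.
apply: is_derive_add_dir => //; exact: fc.
Qed.

Lemma mixed_difference f x v w :
  (forall y, derivable f y v) -> (forall y, derivable ('D_v f) y w) ->
  exists a b : R, [/\ 0 <= a <= 1, 0 <= b <= 1 &
   f (x + v + w) - f (x + v) - f (x + w) + f x =
   'D_w ('D_v f) (x + a *: v + b *: w)].
Proof.
move=> fv fvw.
pose g y := f (y + w) - f y.
have tr y : is_derive y v (fun z => f (z + w)) ('D_v f (y + w)).
  have E : (fun h : R => h^-1 *: (((fun z => f (z + w)) \o shift y) (h *: v) - f (y + w)))
     = (fun h : R => h^-1 *: ((f \o shift (y + w)) (h *: v) - f (y + w))).
    by apply/funext => h /=; rewrite /shift /= addrA.
  apply: DeriveDef; first by rewrite /derivable /= E; exact: fv.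
  by rewrite /derive /= E.
have gd y : is_derive y v g ('D_v f (y + w) - 'D_v f y).
  by apply: is_deriveB; exact/derivableP.
have [a a01 Ea] := @MVT_line g x v (fun y => @ex_derive _ _ _ _ _ _ _ (gd y)).
have [b b01 Eb] := @MVT_line ('D_v f) (x + a *: v) w fvw.
exists a, b; split => //.
rewrite -Eb -(@derive_val _ _ _ _ _ _ _ (gd _)) -Ea /g.
ring.
Qed.

(** The second difference of [f] over the parallelogram with sides [h v] and [h w] does not depend
    on the order of the sides. By [mixed_difference] it is [h^2] times either mixed derivative at a
    point near [x], and continuity at [x] concludes. *)
Lemma derive_comm f x v w :
  (forall y, derivable f y v) -> (forall y, derivable f y w) ->
  (forall y, derivable ('D_v f) y w) -> (forall y, derivable ('D_w f) y v) ->
  {for x, continuous ('D_w ('D_v f))} -> {for x, continuous ('D_v ('D_w f))} ->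
  'D_w ('D_v f) x = 'D_v ('D_w f) x.
Proof.
move=> fv fw fvw fwv c1 c2.
apply/eqP; rewrite -subr_eq0 -normr_eq0; apply/eqP/le_anti.
rewrite normr_ge0 andbT; apply/ler_addgt0Pl => e e0; rewrite addr0.
have e2 : 0 < e / 2 by rewrite divr_gt0.
move/cvgrPdist_le : c1 => /(_ _ e2) /nbhs_ballP[d1 /= d10 dP1].
move/cvgrPdist_le : c2 => /(_ _ e2) /nbhs_ballP[d2 /= d20 dP2].
pose N := `|v| + `|w| + 1.
have N0 : 0 < N by rewrite /N ltr_wpDl.
have [h h0 hN] : exists2 h, 0 < h & h * N < Num.min d1 d2.
  have m0 : 0 < Num.min d1 d2 by rewrite lt_min d10.
  exists (Num.min d1 d2 / N / 2); first by rewrite !divr_gt0.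
  by rewrite mulrAC divfK ?gt_eqF//; lra.
have sd g y z (c : R) : derivable g y z -> derivable g y (c *: z).
  by move=> /(is_derive_scale_dir c)[].
have sE g z (c : R) : (forall y, derivable g y z) ->
    'D_(c *: z) g = (fun y => c * 'D_z g y).
  by move=> gz; apply/funext => y; case: (is_derive_scale_dir c (gz y)).
have sEp g y z (c : R) : derivable g y z -> 'D_(c *: z) g y = c * 'D_z g y.
  by move=> gz; case: (is_derive_scale_dir c gz).
have cd g y z (c : R) : derivable g y z -> derivable (fun y => c * g y) y z.
  by move=> gz; apply: (@derivableZ _ _ _ g c).
have cE g y z (c : R) : derivable g y z -> 'D_z (fun y => c * g y) y = c * 'D_z g y.
  by move=> gz; apply: (@deriveZ _ _ _ g c).
have [a [b [a01 b01 Eab]]] := @mixed_difference f x (h *: v) (h *: w)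
  (fun y => sd _ _ _ _ (fv y))
  (fun y => eq_ind_r (fun g => derivable g y (h *: w)) (cd _ _ _ _ (sd _ _ _ _ (fvw y)))
     (sE f v h fv)).
have [a' [b' [a'01 b'01 Eab']]] := @mixed_difference f x (h *: w) (h *: v)
  (fun y => sd _ _ _ _ (fw y))
  (fun y => eq_ind_r (fun g => derivable g y (h *: v)) (cd _ _ _ _ (sd _ _ _ _ (fwv y)))
     (sE f w h fw)).
have near_x (z1 z2 : V) (p q : R) : 0 <= p <= 1 -> 0 <= q <= 1 -> `|z1| + `|z2| + 1 = N ->
    `|x - (x + p *: (h *: z1) + q *: (h *: z2))| < Num.min d1 d2.
  move=> /andP[p0 p1] /andP[q0 q1] zN; apply: le_lt_trans hN.
  rewrite -addrA opprD addrA subrr add0r normrN -zN.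
  rewrite (le_trans (ler_normD _ _))// !normrZ (ger0_norm p0) (ger0_norm q0).
  rewrite (ger0_norm (ltW h0)) !mulrDr mulr1 -[leLHS]addr0 lerD ?(ltW h0)//.
  by rewrite lerD// ler_piMl// mulr_ge0// ltW.
have := near_x v w a b a01 b01 erefl.
have := near_x w v a' b' a'01 b'01; rewrite /N [`|w| + _]addrC => /(_ erefl).
rewrite !lt_min => /andP[_ n2] /andP[n1 _].
have := dP1 (x + a *: (h *: v) + b *: (h *: w)); rewrite -ball_normE => /(_ n1).
have := dP2 (x + a' *: (h *: w) + b' *: (h *: v)); rewrite -ball_normE => /(_ n2).
move: Eab Eab'; rewrite (sE f v h fv) (sE f w h fw).
rewrite (sEp _ _ w h (cd _ _ _ h (fvw _))) (sEp _ _ v h (cd _ _ _ h (fwv _))).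
rewrite !cE//; set D1 := 'D_w ('D_v f) (_ + _); set D2 := 'D_v ('D_w f) (_ + _).
rewrite [x + h *: w + _]addrAC => E1 E2 H2 H1.
clearbody D1 D2.
have D12 : D1 = D2.
  have hn : h != 0 by rewrite gt_eqF.
  apply: (mulfI hn); apply: (mulfI hn).
  refine (etrans (esym E1) (etrans _ E2)).
  by congr (_ + _); exact: addrAC.
rewrite (_ : _ - _ = ('D_w ('D_v f) x - D1) - ('D_v ('D_w f) x - D2)); last first.
  by rewrite D12 opprB addrA subrK.
by rewrite (le_trans (ler_normB _ _))// [leRHS](splitr e) lerD.
Qed.

Lemma near_line x v (P : set V) : (\forall y \near x, P y) ->
  exists2 r : R, 0 < r & forall s, `|s| < r -> P (x + s *: v).
Proof.
move=> /nbhs_ballP[d /= d0 dP].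
have N0 : 0 < `|v| + 1 by rewrite ltr_wpDl.
exists (d / (`|v| + 1)); first exact: divr_gt0.
move=> s sd; apply: dP; rewrite -ball_normE /= opprD addrA subrr add0r normrN normrZ.
rewrite ltr_pdivlMr// in sd; apply: le_lt_trans sd.
by rewrite ler_wpM2l// lerDl.
Qed.

Lemma derive_local_max f x v : (forall y, derivable f y v) ->
  (\forall y \near x, f y <= f x) -> 'D_v f x = 0.
Proof.
move=> fd /(near_line v)[r r0 H].
pose phi (s : R) := f (x + s *: v).
have in_r (t : R) : t \in `]-r, r[ -> `|t| < r by rewrite in_itv /= ltr_norml.
have [||||_ <-] := @derive1_at_max R phi (- r) r 0.
- by lra.
- by move=> t _; case: (is_derive_line (fd (x + t *: v))).
- by rewrite in_itv /=; lra.
- by move=> t /in_r /H; rewrite {2}/phi scale0r addr0.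
by have [_] := is_derive_line (fd (x + 0 *: v)); rewrite scale0r addr0 => <-.
Qed.

(** If the second derivative were positive near [x], two mean values would write [f (x + s v) - f x]
    as [s * (c s)] times a positive second derivative, since the first derivative vanishes at [x].
    This needs [0 < c], hence the strict form [MVT_line_lt]. *)
Lemma derive2_local_max f x v : (forall y, derivable f y v) ->
  (forall y, derivable ('D_v f) y v) -> {for x, continuous ('D_v ('D_v f))} ->
  (\forall y \near x, f y <= f x) -> 'D_v ('D_v f) x <= 0.
Proof.
move=> fd fdd fc fmax; rewrite leNgt; apply/negP => D0.
have : \forall y \near x, f y <= f x /\ 0 < 'D_v ('D_v f) y.
  near=> y; split; first by near: y.
  by near: y; exact: (cvgr_gt _ fc).
move=> /(near_line v)[r r0 H].
pose s := r / 2.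
have s0 : 0 < s by rewrite divr_gt0.
have sr : s < r by rewrite /s; lra.
have sE g y (c : R) : derivable g y v -> 'D_(c *: v) g y = c * 'D_v g y.
  by move=> gz; case: (is_derive_scale_dir c gz).
have sd g y (c : R) : derivable g y v -> derivable g y (c *: v).
  by move=> /(is_derive_scale_dir c)[].
have [c /andP[c0 c1] Ec] := MVT_line_lt x (fun y => sd _ _ s (fd y)).
have [d /andP[d0 d1] Ed] := MVT_line_lt x (fun y => sd _ _ (c * s) (fdd y)).
move: Ec Ed; rewrite (sE _ _ s (fd _)) (sE _ _ (c * s) (fdd _)) scalerA.
rewrite (derive_local_max fd fmax) subr0 => Ec Ed.
have [|le1 _] := H s; first by rewrite gtr0_norm.
have cs : c * s <= s by rewrite ler_piMl// ltW.
have cs0 : 0 < c * s by rewrite mulr_gt0.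
have [|_ gt2] := H (d * (c * s)).
  rewrite gtr0_norm ?mulr_gt0//; apply: le_lt_trans sr; apply: le_trans cs.
  by rewrite ler_piMl// ltW.
have : 0 < f (x + s *: v) - f x.
  apply: (eq_ind_r (fun z => 0 < z) _ Ec); apply: (mulr_gt0 s0).
  apply: (eq_ind_r (fun z => 0 < z) _ Ed); apply: (mulr_gt0 cs0).
  by rewrite scalerA.
by rewrite subr_gt0 ltNge le1.
Unshelve. all: by end_near. Qed.

End directional.

(** * Functions of class [C^k] and their directional derivatives *)

(* The values of ['D_v f] have as type [R] seen as a normed module; [dd v f] is
   the same function with values in [R], locked to keep unification fast. *)
HB.lock Definition dd (R : realType) (V : normedModType R) (v : V) (f : V -> R)
  (x : V) : R := 'D_v f x.

(** All directions are quantified over, not only a basis, so that derivatives along the vectors of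
    an arbitrary frame are available without conversion. *)
Fixpoint Cn (R : realType) (V : normedModType R) (k : nat) (f : V -> R) : Prop :=
  if k is k'.+1 then
    continuous f /\ forall v, (forall x, derivable f x v) /\ Cn k' (dd v f)
  else continuous f.

Section Cn.
Variables (R : realType) (V : normedModType R).
Implicit Types (f g : V -> R) (x y v w : V) (k : nat).

Lemma ddE v f : dd v f = 'D_v f.
Proof. by rewrite unlock. Qed.

Lemma ddE_at v f x : dd v f x = 'D_v f x.
Proof. by rewrite unlock. Qed.

Lemma is_derive_dd f x v (a : R) : is_derive x v f a -> dd v f x = a.
Proof. by rewrite unlock => -[]. Qed.

Lemma Cn_continuous k f : Cn k f -> continuous f.
Proof. by case: k => [|k] // []. Qed.

Lemma Cn_derivable k f x v : Cn k.+1 f -> derivable f x v.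
Proof. by move=> [_ /(_ v)[]]. Qed.

Lemma Cn_dd k f v : Cn k.+1 f -> Cn k (dd v f).
Proof. by move=> [_ /(_ v)[]]. Qed.

Lemma CnW k f : Cn k.+1 f -> Cn k f.
Proof.
elim: k f => [|k IH] f [fc fd] //; split => // v; have [fv /IH fv'] := fd v.
by split.
Qed.

Lemma Cn_le j k f : (j <= k)%N -> Cn k f -> Cn j f.
Proof.
move=> /subnK <-; elim: (k - j)%N => [|i IH] //; by rewrite addSn => /CnW.
Qed.

Lemma Cn_is_derive k f x v : Cn k.+1 f -> is_derive x v f (dd v f x).
Proof. by rewrite ddE_at => fk; apply/derivableP; exact: Cn_derivable fk. Qed.

Lemma CnS k f (F : V -> V -> R) : continuous f ->
  (forall x v, is_derive x v f (F v x)) -> (forall v, Cn k (F v)) -> Cn k.+1 f.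
Proof.
move=> fc fd Fk; split => // v; split=> [x|]; first by case: (fd x v).
rewrite (_ : dd v f = F v)//; apply/funext => x; exact: is_derive_dd.
Qed.

Lemma ddD k f g v : Cn k.+1 f -> Cn k.+1 g ->
  dd v (fun x => f x + g x) = fun x => dd v f x + dd v g x.
Proof.
move=> fk gk; apply/funext => x; apply: is_derive_dd.
exact: (is_deriveD (Cn_is_derive x v fk) (Cn_is_derive x v gk)).
Qed.

Lemma ddM k f g v : Cn k.+1 f -> Cn k.+1 g ->
  dd v (fun x => f x * g x) = fun x => f x * dd v g x + g x * dd v f x.
Proof.
move=> fk gk; apply/funext => x; apply: is_derive_dd.
exact: (is_deriveM (Cn_is_derive x v fk) (Cn_is_derive x v gk)).
Qed.

Lemma dd_cst v (c : R) : dd v (fun _ : V => c) = fun=> 0.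
Proof. by apply/funext => x; apply: is_derive_dd; exact: is_derive_cst. Qed.

Lemma Cn_cst k (c : R) : Cn k (fun _ : V => c).
Proof.
elim: k c => [|k IH] c; first exact: cst_continuous.
by refine (@CnS k _ (fun _ _ => 0) _ _ _) => [|_]; [exact: cst_continuous|exact: IH].
Qed.

Lemma CnD k f g : Cn k f -> Cn k g -> Cn k (fun x => f x + g x).
Proof.
elim: k f g => [|k IH] f g; first by move=> fc gc x; apply: cvgD; [exact: fc|exact: gc].
move=> Hf Hg; apply: (@CnS k _ (fun v x => dd v f x + dd v g x)) => [x|x v|v].
- by apply: cvgD; [exact: (Cn_continuous Hf)|exact: (Cn_continuous Hg)].
- exact: (is_deriveD (Cn_is_derive x v Hf) (Cn_is_derive x v Hg)).
- by apply: IH; exact: Cn_dd.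
Qed.

Lemma CnM k f g : Cn k f -> Cn k g -> Cn k (fun x => f x * g x).
Proof.
elim: k f g => [|k IH] f g; first by move=> fc gc x; apply: cvgM; [exact: fc|exact: gc].
move=> Hf Hg.
apply: (@CnS k _ (fun v x => f x * dd v g x + g x * dd v f x)) => [x|x v|v].
- by apply: cvgM; [exact: (Cn_continuous Hf)|exact: (Cn_continuous Hg)].
- exact: (is_deriveM (Cn_is_derive x v Hf) (Cn_is_derive x v Hg)).
- by apply: CnD; apply: IH; by [exact: Cn_dd|exact: CnW].
Qed.

Lemma CnZ k f (c : R) : Cn k f -> Cn k (fun x => c * f x).
Proof. by apply: CnM; exact: Cn_cst. Qed.

Lemma ddZ k f v (c : R) : Cn k.+1 f -> dd v (fun x => c * f x) = fun x => c * dd v f x.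
Proof.
move=> fk; rewrite (@ddM k (fun=> c))//; last exact: Cn_cst.
by apply/funext => x; rewrite dd_cst mulr0 addr0.
Qed.

Lemma CnN k f : Cn k f -> Cn k (fun x => - f x).
Proof.
move=> fk; rewrite (_ : (fun x => _) = (fun x => -1 * f x)); first exact: CnZ.
by apply/funext => x; rewrite mulN1r.
Qed.

Lemma CnB k f g : Cn k f -> Cn k g -> Cn k (fun x => f x - g x).
Proof. by move=> fk gk; apply: CnD => //; exact: CnN. Qed.

Lemma ddN k f v : Cn k.+1 f -> dd v (fun x => - f x) = fun x => - dd v f x.
Proof.
move=> fk; rewrite (_ : (fun x => _) = (fun x => -1 * f x)).
  by rewrite (ddZ _ _ fk); apply/funext => x; rewrite mulN1r.
by apply/funext => x; rewrite mulN1r.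
Qed.

Lemma ddB k f g v : Cn k.+1 f -> Cn k.+1 g ->
  dd v (fun x => f x - g x) = fun x => dd v f x - dd v g x.
Proof. by move=> fk gk; rewrite (ddD _ fk (CnN gk)) (ddN _ gk). Qed.

Lemma Cn_sum k (I : Type) (r : seq I) (P : pred I) (F : I -> V -> R) :
  (forall i, Cn k (F i)) -> Cn k (fun x => \sum_(i <- r | P i) F i x).
Proof.
move=> Fk; elim: r => [|i r IH].
  under [X in Cn k X]funext do rewrite big_nil; exact: Cn_cst.
under [X in Cn k X]funext do rewrite big_cons.
by case: (P i) => //; exact: CnD.
Qed.

Lemma dd_sum k (I : Type) (r : seq I) (P : pred I) (F : I -> V -> R) v :
  (forall i, Cn k.+1 (F i)) ->
  dd v (fun x => \sum_(i <- r | P i) F i x) = fun x => \sum_(i <- r | P i) dd v (F i) x.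
Proof.
move=> Fk; elim: r => [|i r IH].
  rewrite (_ : (fun x => _) = fun=> 0); last by apply/funext => x; rewrite big_nil.
  by rewrite dd_cst; apply/funext => x; rewrite big_nil.
have E : (fun x => \sum_(j <- i :: r | P j) F j x) =
    if P i then (fun x => F i x + \sum_(j <- r | P j) F j x)
    else (fun x => \sum_(j <- r | P j) F j x).
  by apply/funext => x; rewrite big_cons; case: ifP.
apply/funext => x; rewrite E big_cons; case: (P i); last by rewrite IH.
by have /= -> := ddD v (Fk i) (Cn_sum r P Fk); rewrite IH.
Qed.

Lemma Cn_prod k (I : Type) (r : seq I) (P : pred I) (F : I -> V -> R) :
  (forall i, Cn k (F i)) -> Cn k (fun x => \prod_(i <- r | P i) F i x).
Proof.
move=> Fk; elim: r => [|i r IH].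
  under [X in Cn k X]funext do rewrite big_nil; exact: Cn_cst.
under [X in Cn k X]funext do rewrite big_cons.
by case: (P i) => //; exact: CnM.
Qed.

Lemma CnV k f : (forall x, f x != 0) -> Cn k f -> Cn k (fun x => (f x)^-1).
Proof.
move=> f0; elim: k => [|k IH] Hf.
  by move=> x; apply: cvgV => //; exact: Hf.
have c0 : Cn k (fun x => (f x)^-1) by apply: IH; exact: CnW.
apply: (@CnS k _ (fun v x => - ((f x)^-1 * (f x)^-1 * dd v f x))) => [|x v|v].
- exact: (Cn_continuous c0).
- have fd : derivable f x v by exact: Cn_derivable Hf.
  apply: DeriveDef; first exact: derivableV.
  by rewrite deriveV// -ddE_at /GRing.scale/= mulNr expr2 invfM.
- by apply: CnN; apply: CnM; [exact: CnM|exact: Cn_dd].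
Qed.

Lemma dd_lincomb f (I : finType) (v : I -> V) (a : I -> R) x : Cn 1 f ->
  dd (\sum_i a i *: v i) f x = \sum_i a i * dd (v i) f x.
Proof.
move=> Hf.
have D i y : is_derive y (a i *: v i) f (a i * dd (v i) f y).
  rewrite ddE_at; apply: is_derive_scale_dir; exact: Cn_derivable Hf.
have E i : dd (a i *: v i) f = fun y => a i * dd (v i) f y.
  by apply/funext => y; exact: is_derive_dd.
apply: etrans (is_derive_dd (@derive_sum_dir R V f I _ (fun i => a i *: v i) _ _ x)) _.
- by move=> i y; case: (D i y).
- move=> i; rewrite -ddE E; apply: (@Cn_continuous 0); apply: CnZ; exact: Cn_dd.
- by apply: eq_bigr => i _; rewrite -ddE_at E.
Qed.

Lemma dd_comm f v w : Cn 2 f -> dd w (dd v f) = dd v (dd w f).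
Proof.
move=> Hf; apply/funext => x.
have c a b : continuous (dd a (dd b f)).
  exact: (Cn_continuous (@Cn_dd 0 _ a (@Cn_dd 1 _ b Hf))).
have d1 g a y : Cn 1 g -> derivable g y a by exact: Cn_derivable.
have dv y : derivable (dd v f) y w by exact: d1 (@Cn_dd 1 _ v Hf).
have dw y : derivable (dd w f) y v by exact: d1 (@Cn_dd 1 _ w Hf).
have fv y a : derivable f y a by exact: d1 (CnW Hf).
have := c w v x; have := c v w x; rewrite !ddE => cw cv.
rewrite !ddE in dv dw.
exact: (derive_comm (fun y => fv y v) (fun y => fv y w) dv dw cv cw).
Qed.

Lemma CnX k f j : Cn k f -> Cn k (fun x => f x ^+ j).
Proof.
move=> fk; elim: j => [|j IH].
  under [X in Cn k X]funext do rewrite expr0; exact: Cn_cst.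
by under [X in Cn k X]funext do rewrite exprS; exact: CnM.
Qed.

Lemma dd_local_max f x v : Cn 1 f -> (\forall y \near x, f y <= f x) -> dd v f x = 0.
Proof.
move=> f1 fmax; rewrite ddE_at; apply: derive_local_max => // y.
exact: Cn_derivable f1.
Qed.

Lemma dd2_local_max f x v : Cn 2 f -> (\forall y \near x, f y <= f x) ->
  dd v (dd v f) x <= 0.
Proof.
move=> f2 fmax; rewrite ddE_at ddE; apply: derive2_local_max => //.
- by move=> y; exact: Cn_derivable f2.
- by move=> y; rewrite -ddE; exact: Cn_derivable (@Cn_dd 1 _ v f2).
- rewrite -!ddE; exact: (Cn_continuous (@Cn_dd 0 _ v (@Cn_dd 1 _ v f2))).
Qed.

End Cn.

Section Cn_rV.
Variables (R : realType) (n : nat).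

Lemma is_derive_coord (x v : 'rV[R]_n) i :
  is_derive x v (fun y : 'rV[R]_n => y 0 i) (v 0 i).
Proof.
have d0 : derivable (id : 'rV[R]_n -> 'rV[R]_n) x v by exact: derivable_id.
have d := (@derivable_mxP R _ 1 n id x v).1 d0 0 i.
apply: DeriveDef => //; have := derive_mx d0.
by rewrite derive_id => /matrixP/(_ 0 i); rewrite mxE => <-.
Qed.

Lemma dd_coord (v : 'rV[R]_n) i : dd v (fun y : 'rV[R]_n => y 0 i) = fun=> v 0 i.
Proof. by apply/funext => x; exact/is_derive_dd/is_derive_coord. Qed.

Lemma Cn_coord k i : Cn k (fun y : 'rV[R]_n => y 0 i).
Proof.
case: k => [|k]; first exact: coord_continuous.
refine (@CnS R _ k _ (fun (v _ : 'rV[R]_n) => v 0 i) _ (fun x v => is_derive_coord x v i) _) => [|v].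
  exact: coord_continuous.
exact: Cn_cst.
Qed.

Lemma dd_partial (f : 'rV[R]_n -> R) (v x : 'rV[R]_n) : Cn 1 f ->
  dd v f x = \sum_i v 0 i * dd (delta_mx 0 i) f x.
Proof. by move=> f1; rewrite {1}(row_sum_delta v) dd_lincomb. Qed.

(** [smooth] speaks only of coordinate directions. A derivative along [v] is a combination of
    partial derivatives because these are continuous; the induction on [k] needs the claim for all
    iterated partials at once. *)
Lemma smooth_Cn (m : nat) (u : 'rV[R]_n -> 'rV[R]_m) k (a : 'I_m) :
  smooth u -> Cn k (fun x => u x 0 a).
Proof.
move=> us.
suff H s : Cn k (fun x => iter_partial s u x 0 a) by exact: (H [::]).
elim: k s => [|k IH] s; have [sc sd] := us s.
  by move=> x; exact: (cvg_comp _ _ (sc x) (@coord_continuous R 1 m 0 a _)).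
have sca : continuous (fun x => iter_partial s u x 0 a).
  by move=> x; exact: (cvg_comp _ _ (sc x) (@coord_continuous R 1 m 0 a _)).
split => // v.
pose f x := iter_partial s u x 0 a.
have fE i x : is_derive x (delta_mx 0 i) f (iter_partial (i :: s) u x 0 a).
  have d := (@derivable_mxP R _ 1 m _ x (delta_mx 0 i)).1 (sd i x) 0 a.
  apply: DeriveDef => //; rewrite /= /partial.
  by have /matrixP/(_ 0 a) := derive_mx (sd i x); rewrite mxE => ->.
have D i y : is_derive y (v 0 i *: delta_mx 0 i) f (v 0 i * iter_partial (i :: s) u y 0 a).
  by have [d <-] := fE i y; exact: is_derive_scale_dir.
have E x : is_derive x v f (\sum_i v 0 i * iter_partial (i :: s) u x 0 a).
  rewrite {1}(row_sum_delta v).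
  have -> : \sum_i v 0 i * iter_partial (i :: s) u x 0 a =
      \sum_i 'D_(v 0 i *: delta_mx 0 i) f x.
    by apply: eq_bigr => i _; case: (D i x).
  apply: derive_sum_dir => [i y|i]; first by case: (D i y).
  have -> : 'D_(v 0 i *: delta_mx 0 i) f = fun y => v 0 i * iter_partial (i :: s) u y 0 a.
    by apply/funext => y; case: (D i y).
  apply: (@Cn_continuous R _ 0).
  by apply: CnZ; exact: (Cn_le (leq0n k)).
split=> [x|]; first by case: (E x).
rewrite (_ : dd v _ = fun x => \sum_i v 0 i * iter_partial (i :: s) u x 0 a).
  by apply: Cn_sum => i; apply: CnZ; exact: IH.
by apply/funext => x; exact: is_derive_dd.
Qed.

End Cn_rV.

(** * Maximum principle for the drift Laplacian *)

Lemma sum2_lincomb (R : comPzRingType) (I J : finType) (a b : R) (g A B C : I -> J -> R) :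
  (forall i j, C i j = a * A i j + b * B i j) ->
  \sum_i \sum_j g i j * C i j =
  a * (\sum_i \sum_j g i j * A i j) + b * (\sum_i \sum_j g i j * B i j).
Proof.
move=> E; rewrite !mulr_sumr -big_split /=; apply: eq_bigr => i _.
rewrite !mulr_sumr -big_split /=; apply: eq_bigr => j _.
by rewrite E mulrDr !(mulrCA (g i j)).
Qed.

Section elliptic.
Variables (R : realType) (n : nat).
Notation V := 'rV[R]_n.
Variable G : V -> 'M[R]_n.

Notation d i := (delta_mx 0 i : V).

(** The point also serves as direction: [dd x f x] is [x.Df], to be expanded by [dd_partial] when
    its dependence on [x] matters. *)
Definition drift_laplacian (f : V -> R) (x : V) : R :=
  \sum_i \sum_j G x i j * dd (d i) (dd (d j) f) x - 2^-1 * dd x f x.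

Notation L := drift_laplacian.

Definition carre_du_champ (f : V -> R) (x : V) : R :=
  \sum_i \sum_j G x i j * (dd (d i) f x * dd (d j) f x).

Lemma drift_laplacianD f g x : Cn 2 f -> Cn 2 g ->
  L (fun y => f y + g y) x = L f x + L g x.
Proof.
move=> f2 g2.
have E2 i j : dd (d i) (dd (d j) (fun y => f y + g y)) x =
    1 * dd (d i) (dd (d j) f) x + 1 * dd (d i) (dd (d j) g) x.
  by rewrite (ddD _ f2 g2) (ddD _ (Cn_dd _ f2) (Cn_dd _ g2)) !mul1r.
by rewrite /drift_laplacian (sum2_lincomb _ E2) !mul1r (ddD _ f2 g2); ring.
Qed.

Lemma drift_laplacianZ (c : R) f x : Cn 2 f -> L (fun y => c * f y) x = c * L f x.
Proof.
move=> f2.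
have E2 i j : dd (d i) (dd (d j) (fun y => c * f y)) x =
    c * dd (d i) (dd (d j) f) x + 0 * 0.
  by rewrite (ddZ _ _ f2) (ddZ _ _ (Cn_dd _ f2)) mul0r addr0.
by rewrite /drift_laplacian (sum2_lincomb _ E2) (ddZ _ _ f2); ring.
Qed.

Lemma drift_laplacian_sqr f x : Cn 2 f ->
  L (fun y => f y * f y) x = 2 * f x * L f x + 2 * carre_du_champ f x.
Proof.
move=> f2; have f1 := CnW f2.
have E2 i j : dd (d i) (dd (d j) (fun y => f y * f y)) x =
    2 * f x * dd (d i) (dd (d j) f) x + 2 * (dd (d i) f x * dd (d j) f x).
  have f'1 := Cn_dd (d j) f2; have fM := CnM f1 f'1.
  by rewrite (ddM _ f2 f2) (ddD _ fM fM) (ddM _ f1 f'1); ring.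
by rewrite /drift_laplacian /carre_du_champ (sum2_lincomb _ E2) (ddM _ f2 f2); field.
Qed.

Hypothesis G_cont : forall i j, continuous (fun x => G x i j).

Lemma drift_laplacian_continuous f : Cn 2 f -> continuous (L f).
Proof.
move=> f2; rewrite (_ : L f = fun x => \sum_i \sum_j G x i j * dd (d i) (dd (d j) f) x
   - 2^-1 * \sum_i x 0 i * dd (d i) f x); last first.
  by apply/funext => x; rewrite /drift_laplacian (dd_partial x x (CnW f2)).
apply: (@Cn_continuous _ _ 0).
have f1 w := Cn_dd w f2.
apply: CnB; last first.
  apply: CnZ; apply: Cn_sum => i; apply: CnM; [exact: Cn_coord|exact: CnW].
apply: Cn_sum => i; apply: Cn_sum => j; apply: CnM; first exact: G_cont.
exact: Cn_dd (f1 _).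
Qed.

Hypothesis G_gram : forall x, exists2 W : 'M[R]_n, W \in unitmx & G x = W^T *m W.
Hypothesis G_tr : forall x, \tr (G x) <= n%:R.

(** Factoring [G] leaves only pure second derivatives along the rows of [W], whose sign at a maximum
    is known. *)
Lemma drift_laplacian_frame f x (W : 'M[R]_n) : Cn 2 f -> G x = W^T *m W ->
  L f x = \sum_a dd (row a W) (dd (row a W) f) x - 2^-1 * dd x f x.
Proof.
move=> f2 GE; rewrite /drift_laplacian GE; congr (_ - _).
have f1 w := Cn_dd w f2.
have E2 a : dd (row a W) (dd (row a W) f) x =
    \sum_i \sum_j W a i * W a j * dd (d i) (dd (d j) f) x.
  rewrite (dd_partial _ _ (f1 _)); apply: eq_bigr => i _; rewrite mxE dd_comm//.
  rewrite (dd_partial _ _ (f1 _)) mulr_sumr; apply: eq_bigr => j _.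
  by rewrite mxE dd_comm// mulrA.
rewrite [RHS](eq_bigr _ (fun a _ => E2 a)) [RHS]exchange_big /=; apply: eq_bigr => i _.
rewrite [RHS]exchange_big /=; apply: eq_bigr => j _.
by rewrite mxE mulr_suml; apply: eq_bigr => a _; rewrite mxE.
Qed.

Lemma drift_laplacian_local_max f x : Cn 2 f ->
  (\forall y \near x, f y <= f x) -> L f x <= 0.
Proof.
move=> f2 fmax; have [W _ GE] := G_gram x.
rewrite (drift_laplacian_frame f2 GE) (dd_local_max _ (CnW f2) fmax) mulr0 subr0.
by apply: sumr_le0 => a _; exact: dd2_local_max.
Qed.

Definition sqdist (x y : V) : R := \sum_i (x 0 i - y 0 i) ^+ 2.

(** It serves twice: as the barrier that vanishes on a sphere about [y], and, with [c = 0] and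
    [y = 0], as the penalty [-|x|^2]. *)
Definition paraboloid (c : R) (y x : V) : R := c - sqdist x y.

Lemma sqdist_ge0 x y : 0 <= sqdist x y.
Proof. by apply: sumr_ge0 => i _; exact: sqr_ge0. Qed.

Lemma sqdist_coord (x y : V) i : (x 0 i - y 0 i) ^+ 2 <= sqdist x y.
Proof.
by rewrite /sqdist (bigD1 i)//= lerDl; apply: sumr_ge0 => j _; exact: sqr_ge0.
Qed.

Lemma Cn_sqdist k y : Cn k (fun x => sqdist x y).
Proof.
apply: Cn_sum => i; apply: CnX; apply: CnB; [exact: Cn_coord|exact: Cn_cst].
Qed.

Lemma Cn_paraboloid k c y : Cn k (paraboloid c y).
Proof. apply: CnB; [exact: Cn_cst|exact: Cn_sqdist]. Qed.

Lemma dd_paraboloid c (y v : V) : dd v (paraboloid c y) = fun x => -2 * \sum_i v 0 i * (x 0 i - y 0 i).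
Proof.
have C1 i : Cn 1 (fun x : V => x 0 i - y 0 i).
  by apply: CnB; [exact: Cn_coord|exact: Cn_cst].
have C2 i : Cn 1 (fun x : V => (x 0 i - y 0 i) ^+ 2) by exact: CnX.
rewrite /paraboloid (ddB _ (Cn_cst _ _ _) (Cn_sqdist 1 y)) dd_cst /sqdist (dd_sum _ _ _ C2).
apply/funext => x; rewrite sub0r mulNr mulr_sumr; congr (- _); apply: eq_bigr => i _.
rewrite (_ : (fun x : V => (x 0 i - y 0 i) ^+ 2) =
  fun x => (x 0 i - y 0 i) * (x 0 i - y 0 i))//.
rewrite (ddM _ (C1 i) (C1 i)) (ddB _ (Cn_coord _ 1 i) (Cn_cst _ 1 _)) dd_coord dd_cst.
ring.
Qed.

Lemma dd2_paraboloid c (y v w : V) : dd w (dd v (paraboloid c y)) = fun x => - 2 * \sum_i v 0 i * w 0 i.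
Proof.
have C1 i : Cn 1 (fun x : V => x 0 i - y 0 i).
  by apply: CnB; [exact: Cn_coord|exact: Cn_cst].
have C2 i : Cn 1 (fun x : V => v 0 i * (x 0 i - y 0 i)) by exact: CnZ.
rewrite dd_paraboloid (ddZ _ _ (Cn_sum _ _ C2)) (dd_sum _ _ _ C2).
apply/funext => x; congr (_ * _); apply: eq_bigr => i _.
by rewrite (ddZ _ _ (C1 i)) (ddB _ (Cn_coord _ 1 i) (Cn_cst _ 1 _)) dd_coord dd_cst subr0.
Qed.

Lemma sum_delta (F : 'I_n -> R) i : \sum_k d i 0 k * F k = F i.
Proof.
rewrite (bigD1 i)//= big1 ?addr0 => [|k ki]; first by rewrite mxE !eqxx mul1r.
by rewrite mxE (negbTE ki) andbF mul0r.
Qed.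

Lemma drift_laplacian_paraboloid c (y x : V) :
  L (paraboloid c y) x = - 2 * \tr (G x) + \sum_i x 0 i * (x 0 i - y 0 i).
Proof.
rewrite /drift_laplacian dd_paraboloid; congr (_ + _).
  rewrite mulr_sumr; apply: eq_bigr => i _.
  under eq_bigr do rewrite dd2_paraboloid sum_delta mulrC -mulrA.
  rewrite -mulr_sumr; congr (_ * _); rewrite -[RHS]sum_delta.
  by apply: eq_bigr => j _; rewrite !mxE eq_sym.
by rewrite mulrA mulrN mulVf// mulN1r opprK.
Qed.

Lemma carre_du_champ_paraboloid_gt0 c y x : x != y -> 0 < carre_du_champ (paraboloid c y) x.
Proof.
move=> xy; have [W Wu GE] := G_gram x.
have Dd i : dd (d i) (paraboloid c y) x = -2 * (x 0 i - y 0 i).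
  by rewrite dd_paraboloid sum_delta.
pose z := W *m (x - y)^T.
have -> : carre_du_champ (paraboloid c y) x = 4 * \sum_a (z a 0) ^+ 2.
  rewrite /carre_du_champ GE mulr_sumr.
  under eq_bigr => i _ do under eq_bigr => j _ do rewrite !Dd mxE mulr_suml.
  under eq_bigr => i _ do rewrite exchange_big /=.
  rewrite exchange_big /=; apply: eq_bigr => a _.
  have -> : z a 0 = \sum_i W a i * (x 0 i - y 0 i).
    by rewrite mxE; apply: eq_bigr => i _; rewrite !mxE.
  rewrite expr2 mulr_suml mulr_sumr; apply: eq_bigr => i _.
  rewrite mulr_sumr mulr_sumr; apply: eq_bigr => j _; rewrite mxE; ring.
rewrite mulr_gt0// lt_neqAle sumr_ge0 ?andbT => [|a _]; last exact: sqr_ge0.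
rewrite eq_sym psumr_eq0 => [|a _]; last exact: sqr_ge0.
apply: contra xy => /allP H.
have z0 : z = 0.
  apply/matrixP => a b; rewrite (ord1 b) [RHS]mxE; apply/eqP.
  by rewrite -sqrf_eq0; exact: (H a (mem_index_enum _)).
have : (x - y)^T = 0 by rewrite -(mulKmx Wu (x - y)^T) -/z z0 mulmx0.
by move=> /(congr1 trmx); rewrite trmxK trmx0 => /eqP; rewrite subr_eq0.
Qed.

End elliptic.

(** * Compact boxes and balls, attained extrema *)

Section compactness.
Variables (R : realType) (n : nat).
Notation V := 'rV[R]_n.
Implicit Types (x y z : V) (f g : V -> R).

Definition box z (r : R) : set V := [set x | forall i, `|x 0 i - z 0 i| <= r].

Lemma box_compact z r : compact (box z r).
Proof.
have := @rV_compact R n (fun i => `[z 0 i - r, z 0 i + r]%classic).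
have E : [set v : V | forall i, `[z 0 i - r, z 0 i + r]%classic (v ord0 i)] = box z r.
  apply/seteqP; split => x /= H i; have := H i; rewrite /= in_itv /= ler_distl//.
by rewrite E; apply=> i; exact: segment_compact.
Qed.

Lemma closed_sublevel f (c : R) : continuous f -> closed [set x | f x <= c].
Proof. move=> /continuous_closedP/(_ _ (@closed_le R c)); exact. Qed.

Lemma closed_superlevel f (c : R) : continuous f -> closed [set x | c <= f x].
Proof. move=> /continuous_closedP/(_ _ (@closed_ge R c)); exact. Qed.

Lemma sqdist_le_box y (S : R) : [set x | sqdist x y <= S] `<=` box y (S + 1).
Proof.
move=> x /= xS i; have := le_trans (sqdist_coord x y i) xS.
rewrite -real_normK ?num_real//; set a := `|_| => aS.
have : 0 <= a by exact: normr_ge0.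
nra.
Qed.

Lemma sqdist_compact y (S : R) : compact [set x | sqdist x y <= S].
Proof.
apply: (subclosed_compact _ (@box_compact y (S + 1))); last exact: sqdist_le_box.
exact: closed_sublevel (Cn_continuous (Cn_sqdist 0 y)).
Qed.

Lemma continuous_max_on f (K : set V) : K !=set0 -> compact K -> continuous f ->
  exists2 c, K c & forall x, K x -> f x <= f c.
Proof.
move=> K0 Kc fc; have [|c cK cM] := @EVT_max_rV R n f K K0 Kc.
  exact: continuous_subspaceT.
by exists c; [rewrite inE in cK|move=> x Kx; apply: cM; rewrite inE].
Qed.

Lemma continuous_min_on f (K : set V) : K !=set0 -> compact K -> continuous f ->
  exists2 c, K c & forall x, K x -> f c <= f x.
Proof.
move=> K0 Kc fc; have [|c cK cM] := @EVT_min_rV R n f K K0 Kc.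
  exact: continuous_subspaceT.
by exists c; [rewrite inE in cK|move=> x Kx; apply: cM; rewrite inE].
Qed.

Lemma near_box z (P : set V) : (\forall x \near z, P x) ->
  exists2 r, 0 < r & forall x, box z r x -> P x.
Proof.
move=> /nbhs_ballP[e /= e0 eP]; exists (e / 2); first exact: divr_gt0.
move=> x xb; apply: eP; split=> // i j; rewrite (ord1 i) /ball /= distrC.
by apply: le_lt_trans (xb j) _; lra.
Qed.

Lemma box_near z r (x : V) : sqdist x z < r ^+ 2 -> 0 < r ->
  \forall y \near x, box z r y.
Proof.
move=> xr r0; have : \forall y \near x, sqdist y z < r ^+ 2.
  exact: (cvgr_lt _ (Cn_continuous (Cn_sqdist 0 z) (x := x))).
apply: filterS => y yr i; have := le_lt_trans (sqdist_coord y z i) yr.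
rewrite -[(_ - _) ^+ 2]real_normK ?num_real// ltr_pXn2r// ?nnegrE ?(ltW r0)//.
exact: ltW.
Qed.

End compactness.

(** * Strong maximum principle and Liouville theorem *)

Section maximum_principle.
Variables (R : realType) (n : nat).
Notation V := 'rV[R]_n.
Variable G : V -> 'M[R]_n.
Hypothesis G_cont : forall i j, continuous (fun x => G x i j).
Hypothesis G_gram : forall x, exists2 W : 'M[R]_n, W \in unitmx & G x = W^T *m W.
Hypothesis G_tr : forall x, \tr (G x) <= n%:R.
Notation L := (drift_laplacian G).

Lemma midpoint_sqdist (x y z : V) :
  sqdist x (2^-1 *: (y + z)) = sqdist x y / 2 + sqdist x z / 2 - sqdist z y / 4.
Proof.
rewrite /sqdist !mulr_suml -big_split -sumrB /=; apply: eq_bigr => i _.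
by rewrite !mxE; field.
Qed.

(** Where [q = 0], [L (q + K q^2)] equals [L q] plus [2 K] times the carre du champ of [q], which is
    positive away from the center; a large [K] therefore decides the sign. *)
Lemma hopf_barrier (y z : V) : z != y ->
  exists K : R, 0 < L (fun x => paraboloid (sqdist z y) y x +
     K * (paraboloid (sqdist z y) y x * paraboloid (sqdist z y) y x)) z.
Proof.
move=> zy; set q := paraboloid _ y.
have q2 k : Cn k q by exact: Cn_paraboloid.
have qz : q z = 0 by rewrite /q /paraboloid subrr.
have g0 := carre_du_champ_paraboloid_gt0 G_gram (sqdist z y) zy.
exists ((`|L q z| + 1) / (2 * carre_du_champ G q z)).
rewrite drift_laplacianD//; last by apply: CnZ; exact: CnM.
rewrite drift_laplacianZ; last exact: CnM.
rewrite drift_laplacian_sqr// qz mulr0 mul0r add0r divfK ?gt_eqF ?mulr_gt0//.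
by have := ler_norm (- L q z); rewrite normrN; lra.
Qed.

(** If [f y < M], let [z] be a point of the set [f = M] nearest to [y]. A barrier [h] with [L h > 0]
    near [z], for a ball touching this set only at [z], is added to [f] with a small factor; the sum
    would have a maximum over a box about [z] that can lie neither near [z] nor far from it. *)
Lemma strong_maximum_principle f (x0 : V) : Cn 2 f -> (forall x, 0 <= L f x) ->
  (forall x, f x <= f x0) -> forall y, f y = f x0.
Proof.
move=> f2 Lf fmax y; set M := f x0.
apply/eqP; apply: contraT => fyM.
have fc := Cn_continuous f2.
have AC : compact ([set x | sqdist x y <= sqdist x0 y] `&` [set x | M <= f x]).
  apply: (subclosed_compact _ (@sqdist_compact _ _ y (sqdist x0 y))).
    apply: closedI; last exact: closed_superlevel.
    exact: closed_sublevel (Cn_continuous (Cn_sqdist 0 y)).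
  by move=> x [].
have [|z [zS zM] zmin] := continuous_min_on _ AC (Cn_continuous (Cn_sqdist 0 y)).
  by exists x0; split => /=.
have fzM : f z = M by apply/le_anti; rewrite fmax zM.
have {}zmin x : f x = M -> sqdist z y <= sqdist x y.
  move=> fx; have [xy|xy] := lerP (sqdist x y) (sqdist x0 y).
    by apply: zmin; split => //=; rewrite fx.
  exact: le_trans zS (ltW xy).
have zy : z != y by apply: contraNneq fyM => <-; rewrite fzM.
(* The ball about the midpoint [w] through [z] is internally tangent to the one about [y], so it
   meets the set [f = M] only at [z]; [qA] is the quantitative form. *)
pose w := 2^-1 *: (y + z).
have zw : z != w.
  apply: contraNneq zy => zE; rewrite -subr_eq0; apply/eqP/rowP => i.
  move/rowP: zE => /(_ i); rewrite !mxE; lra.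
have [K LK] := hopf_barrier zw.
set q := paraboloid (sqdist z w) w in LK; pose h x := q x + K * (q x * q x).
have q2 k : Cn k q by exact: Cn_paraboloid.
have h2 : Cn 2 h by apply: CnD => //; apply: CnZ; exact: CnM.
have qz : q z = 0 by rewrite /q /paraboloid subrr.
have : \forall x \near z, 0 < L h x /\ 0 < 1 + K * q x.
  near=> x; split; near: x.
    exact: (cvgr_gt _ (drift_laplacian_continuous G_cont h2 (x := z))).
  have cK : Cn 0 (fun x => 1 + K * q x) by apply: CnD; [exact: Cn_cst|exact: CnZ].
  by apply: (cvgr_gt _ (cK z)); rewrite qz mulr0 addr0.
move=> /near_box[r r0 rP].
have bz : box z r z by move=> i; rewrite subrr normr0 ltW.
have qA x : f x = M -> q x <= - sqdist x z / 2.
  move=> fx; rewrite /q /paraboloid /w !midpoint_sqdist; have := zmin x fx.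
  have -> : sqdist z z = 0 by rewrite /sqdist big1// => i _; rewrite subrr expr0n.
  lra.
(* The part of the touching ball away from [z] is compact and avoids the set [f = M], so [f] stays
   below some [m < M] there. *)
pose S := box z r `&` ([set x | 0 <= q x] `&` [set x | r ^+ 2 <= sqdist x z]).
have SC : compact S.
  apply: (subclosed_compact _ (@box_compact _ _ z r)); last by move=> x [].
  apply: closedI; first by apply: compact_closed; [exact: norm_hausdorff|exact: box_compact].
  apply: closedI; apply: closed_superlevel; first exact: (Cn_continuous (q2 0%N)).
  exact: (Cn_continuous (Cn_sqdist 0 z)).
have [m mM fm] : exists2 m, m < M & forall x, S x -> f x <= m.
  have [S0|S0] := pselect (S !=set0); last first.
    by exists (M - 1); [lra|move=> x Sx; exfalso; apply: S0; exists x].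
  have [c [cb [/= cq cz]] cmax] := continuous_max_on S0 SC fc.
  exists (f c) => //; rewrite lt_neqAle fmax andbT; apply/eqP => fcM.
  have := qA c fcM; have : 0 < r ^+ 2 by rewrite exprn_gt0.
  lra.
have [H _ Hmax] : exists2 c, box z r c & forall x, box z r x -> h x <= h c.
  apply: continuous_max_on; [by exists z|exact: box_compact|exact: (Cn_continuous h2)].
have hz : h z = 0 by rewrite /h qz !mulr0 addr0.
have hH0 : 0 <= h H by rewrite -hz; exact: Hmax.
have [e e0 eH] : exists2 e, 0 < e & e * h H < M - m.
  exists ((M - m) / (h H + 1)); first by rewrite divr_gt0//; lra.
  rewrite mulrAC ltr_pdivrMr; last lra.
  by rewrite ltr_pM2l ?subr_gt0//; lra.
pose F x := f x + e * h x.
have F2 : Cn 2 F by apply: CnD => //; exact: CnZ.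
have [c cb cmax] : exists2 c, box z r c & forall x, box z r x -> F x <= F c.
  apply: continuous_max_on; [by exists z|exact: box_compact|exact: (Cn_continuous F2)].
have Fc : M <= F c by have := cmax z bz; rewrite {1}/F hz mulr0 addr0 fzM.
have [Lh Kq] := rP c cb.
have [cr|cr] := ltrP (sqdist c z) (r ^+ 2).
  have : L F c <= 0.
    apply: (drift_laplacian_local_max G_gram F2).
    apply: filterS (box_near cr r0) => x; exact: cmax.
  rewrite drift_laplacianD//; last exact: CnZ.
  by rewrite drift_laplacianZ//; have := Lf c; have := mulr_gt0 e0 Lh; lra.
(* [F c >= M >= f c] forces [h c >= 0], and [1 + K * q c > 0] passes the sign on to [q c]. So [c]
   lies in [S], where [f c <= m] and [e * h c < M - m] contradict [M <= F c]. *)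
have hc0 : 0 <= h c.
  by rewrite -(pmulr_rge0 _ e0); have := fmax c; rewrite -/M; move: Fc; rewrite /F; lra.
have qc : 0 <= q c.
  rewrite -(pmulr_rge0 _ Kq); move: hc0; rewrite /h; congr (_ <= _); ring.
have := fm c (conj cb (conj qc cr)).
have : e * h c <= e * h H by rewrite ler_pM2l//; exact: Hmax.
by move: Fc; rewrite /F; lra.
Unshelve. all: by end_near. Qed.

(* [|x|^2] is a Lyapunov function: [L |x|^2 <= 2n - |x|^2], so a bounded
   subsolution penalized by a small multiple of it attains its maximum in a
   fixed ball. *)
Lemma liouville f (B : R) : Cn 2 f -> (forall x, 0 <= L f x) ->
  (forall x, f x <= B) -> forall x y, f x = f y.
Proof.
move=> f2 Lf fB; have fc := Cn_continuous f2.
pose K := [set x : V | sqdist x 0 <= 2 * n%:R].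
have sq00 : sqdist (0 : V) 0 = 0.
  by rewrite /sqdist big1// => i _; rewrite subrr expr0n.
have K0 : K !=set0 by exists 0; rewrite /K /= sq00 mulr_ge0.
have [x0 x0K x0max] := continuous_max_on K0 (@sqdist_compact _ _ _ _) fc.
suff gmax x : f x <= f x0.
  by move=> x y; rewrite !(strong_maximum_principle f2 Lf gmax).
apply/ler_addgt0Pl => e e0.
(* The penalty then costs at most [e] at the given point [x]. *)
pose a := e / (sqdist x 0 + 1).
have N0 : 0 < sqdist x 0 + 1 by have := sqdist_ge0 x 0; lra.
have a0 : 0 < a by exact: divr_gt0.
pose F y := f y + a * paraboloid 0 0 y.
have F2 : Cn 2 F by apply: CnD => //; apply: CnZ; exact: Cn_paraboloid.
have FE y : F y = f y - a * sqdist y 0 by rewrite /F /paraboloid sub0r mulrN.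
have ax : a * sqdist x 0 <= e.
  rewrite /a mulrAC ler_pdivrMr//; apply: ler_wpM2l; [exact: ltW|by rewrite lerDl].
suff [c cK cmax] : exists2 c, K c & F x <= F c.
  have := x0max c cK; have := sqdist_ge0 c 0; have := cmax; rewrite !FE.
  have : 0 <= a * sqdist c 0 by rewrite mulr_ge0 ?sqdist_ge0 ?ltW.
  lra.
(* Where [sqdist y 0 > S], already [F y <= B - a * sqdist y 0 < F x], so a maximum over the slightly
   larger ball is global. *)
pose S := (B - F x) / a.
have [xS|xS] := lerP (sqdist x 0) S; last first.
  exfalso; move: xS; rewrite /S ltr_pdivrMr// mulrC FE; have := fB x; lra.
have S0 : [set y : V | sqdist y 0 <= S + 1] !=set0 by exists x => /=; lra.
have [c cS cmax] := continuous_max_on S0 (@sqdist_compact _ _ _ _) (Cn_continuous F2).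
have gl y : F y <= F c.
  have [yS|yS] := lerP (sqdist y 0) (S + 1); first exact: cmax.
  have xc : F x <= F c by apply: cmax => /=; lra.
  apply: le_trans xc; rewrite FE.
  have : B - F x <= a * sqdist y 0.
    rewrite mulrC -ler_pdivrMr// -/S; lra.
  by have := fB y; lra.
exists c => //; rewrite /K /=.
(* At the maximum, [0 >= L F c >= a * (|c|^2 - 2 tr G)], and the trace bound puts [c] in [K]. *)
have : L F c <= 0 by apply: (drift_laplacian_local_max G_gram F2); exact: (@nearW _ (nbhs c) _ _ gl).
rewrite drift_laplacianD//; last by apply: CnZ; exact: Cn_paraboloid.
rewrite drift_laplacianZ; last exact: Cn_paraboloid.
rewrite drift_laplacian_paraboloid => LF.
have : -2 * \tr (G c) + \sum_i c 0 i * (c 0 i - (0 : V) 0 i) <= 0.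
  by rewrite -(pmulr_rle0 _ a0); have := Lf c; lra.
have -> : \sum_i c 0 i * (c 0 i - (0 : V) 0 i) = sqdist c 0.
  by apply: eq_bigr => i _; rewrite !mxE subr0 expr2.
by have := G_tr c; lra.
Qed.

End maximum_principle.

(** * Orthonormal frames *)

Section spectral.
Variable R : realType.

Lemma dotDr (K : comPzRingType) m (x y z : 'rV[K]_m) : dot z (x + y) = dot z x + dot z y.
Proof. by rewrite !(dotC z) dotDl. Qed.

Lemma dotZr (K : comPzRingType) m c (x z : 'rV[K]_m) : dot z (c *: x) = c * dot z x.
Proof. by rewrite !(dotC z) dotZl. Qed.

Lemma dot_mulmx (K : comPzRingType) m n (x : 'rV[K]_m) (S : 'M[K]_(n, m)) (y : 'rV[K]_n) :
  dot x (y *m S) = dot (x *m S^T) y.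
Proof. by rewrite -!dotE trmx_mul mulmxA. Qed.

(** Along [p + t v] with [v = p S], the quadratic form is [2 t |v|^2 + t^2 N], which is negative for
    small negative [t] unless [v = 0]. *)
Lemma psd_null (n : nat) (S : 'M[R]_n) (p : 'rV[R]_n) : S^T = S ->
  (forall x, 0 <= dot x (x *m S)) -> dot p (p *m S) = 0 -> p *m S = 0.
Proof.
move=> SS S0 p0; set v := p *m S.
apply/eqP; rewrite -dot_eq0; apply/eqP.
have N0 := S0 v; set N := dot v (v *m S) in N0.
have pv : dot p (v *m S) = dot v v by rewrite dot_mulmx SS.
have E t : dot (p + t *: v) ((p + t *: v) *m S) = 2 * t * dot v v + t ^+ 2 * N.
  rewrite mulmxDl -scalemxAl !(dotDl, dotDr) !(dotZl, dotZr) pv -/v p0 -/N; ring.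
have a0 := dot_ge0 v; set a := dot v v in a0 E *.
have := S0 (p + (- a / (1 + N)) *: v); rewrite E.
move: N a a0 N0 {S0 SS p0 pv E} => N a a0 N0.
have N1 : 1 + N != 0 by rewrite gt_eqF//; lra.
have -> : 2 * (- a / (1 + N)) * a + (- a / (1 + N)) ^+ 2 * N =
   - (a ^+ 2 * (2 + N) / (1 + N) ^+ 2) by field.
rewrite oppr_ge0 pmulr_lle0 ?invr_gt0 ?exprn_gt0//; last lra.
rewrite pmulr_lle0; last lra.
by move=> H; apply/eqP; rewrite -sqrf_eq0 -[_ == 0]andbT eq_le H sqr_ge0.
Qed.

(** At a maximizer [p] of the quadratic form on the unit sphere, [f p - S] is positive semidefinite
    and its form vanishes at [p], so [psd_null] makes [p] an eigenvector. *)
Lemma exists_eigenvector (n : nat) (S : 'M[R]_n.+1) : S^T = S ->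
  exists (p : 'rV[R]_n.+1) (mu : R), dot p p = 1 /\ p *m S = mu *: p.
Proof.
move=> SS; pose f (x : 'rV[R]_n.+1) := dot x (x *m S).
have fC : Cn 0 f.
  apply: Cn_sum => i; apply: CnM; first exact: Cn_coord.
  rewrite (_ : (fun x => _) = fun x : 'rV[R]_n.+1 => \sum_j x 0 j * S j i); last first.
    by apply/funext => x; rewrite mxE.
  apply: Cn_sum => j; apply: CnM; [exact: Cn_coord|exact: Cn_cst].
have sqE (x : 'rV[R]_n.+1) : sqdist x 0 = dot x x.
  by apply: eq_bigr => i _; rewrite mxE subr0 expr2.
have Kc : compact ([set x : 'rV[R]_n.+1 | sqdist x 0 <= 1] `&` [set x | 1 <= sqdist x 0]).
  apply: (subclosed_compact _ (@sqdist_compact _ _ (0 : 'rV[R]_n.+1) 1)); last by move=> x [].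
  have c := Cn_continuous (@Cn_sqdist R n.+1 0 0).
  by apply: closedI; [exact: closed_sublevel|exact: closed_superlevel].
have [|p [/= p1 p2] pmax] := continuous_max_on _ Kc fC.
  have e1 : dot (delta_mx 0 0 : 'rV[R]_n.+1) (delta_mx 0 0) = 1.
    rewrite /dot (bigD1 0)//= big1 => [|i i0]; first by rewrite mxE eqxx mulr1 addr0.
    by rewrite mxE (negbTE i0) mulr0.
  by exists (delta_mx 0 0); split; rewrite /= sqE e1.
have pp : dot p p = 1 by apply/le_anti; rewrite -sqE p1 p2.
exists p, (f p); split => //.
have H x : 0 <= dot x (x *m ((f p)%:M - S)).
  rewrite mulmxBr mul_mx_scalar dotC dotBl dotZl -/(f x) dotC.
  have /eqP d0 : dot (0 : 'rV[R]_n.+1) 0 == 0 by rewrite dot_eq0.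
  have [->|x0] := eqVneq x 0; first by rewrite mul0mx d0 mulr0 subr0.
  have xx : 0 < dot x x by rewrite lt_neqAle eq_sym dot_eq0 x0 dot_ge0.
  pose c := (Num.sqrt (dot x x))^-1.
  have cc : c * c = (dot x x)^-1 by rewrite -expr2 exprVn sqr_sqrtr// ltW.
  have := pmax (c *: x); rewrite sqE /f -scalemxAl !(dotZl, dotZr) !mulrA cc.
  rewrite mulVf ?gt_eqF// lexx => /(_ (conj isT isT)).
  by rewrite ler_pdivrMl// subr_ge0 mulrC.
apply/eqP; rewrite eq_sym -subr_eq0 -mul_mx_scalar -mulmxBr.
apply/eqP/psd_null => //; first by rewrite linearB /= tr_scalar_mx SS.
by rewrite mulmxBr mul_mx_scalar dotC dotBl dotZl pp mulr1 dotC subrr.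
Qed.

(** The reflection in the hyperplane orthogonal to [e - p]; it exchanges [e] and [p]. *)
Lemma householder (n : nat) (e p : 'rV[R]_n) : dot e e = 1 -> dot p p = 1 ->
  exists H : 'M[R]_n, [/\ H^T = H, H *m H = 1%:M & e *m H = p].
Proof.
move=> e1 p1; have [<-|ep] := eqVneq e p.
  by exists 1%:M; rewrite trmx1 !mulmx1.
pose w := e - p; pose a := dot w w.
have a0 : a != 0 by rewrite dot_eq0 subr_eq0.
have aE : a = 2 - 2 * dot e p.
  by rewrite /a /w dotBl ![dot _ (e - p)]dotC !dotBl e1 p1 [dot p e]dotC; ring.
have ww : w *m w^T = a%:M.
  by apply/matrixP => i j; rewrite !ord1 dotE mxE eqxx.
exists (1%:M - (2 / a) *: (w^T *m w)); split.
- by rewrite linearB /= linearZ /= trmx_mul trmxK trmx1.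
- have XX : ((2 / a) *: (w^T *m w)) *m ((2 / a) *: (w^T *m w)) =
      2%:R *: ((2 / a) *: (w^T *m w)).
    rewrite -scalemxAl -scalemxAr mulmxA -[w^T *m w *m w^T]mulmxA ww.
    by rewrite mul_mx_scalar -scalemxAl !scalerA; congr (_ *: _); field.
  move: (_ *: _) XX => X XX.
  rewrite mulmxBr mulmx1 mulmxBl mul1mx XX scaler_nat mulr2n.
  by rewrite opprB addrK subrK.
- rewrite mulmxBr mulmx1 -scalemxAr mulmxA.
  have -> : e *m w^T = (a / 2)%:M.
    apply/matrixP => i j; rewrite !ord1 dotE mxE eqxx mulr1n aE.
    by rewrite /w dotC dotBl e1 [dot p e]dotC; field.
  rewrite mul_scalar_mx scalerA [X in X *: _](_ : _ = 1) ?scale1r; last by field.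
  by rewrite /w opprB addrC subrK.
Qed.

(** Deflation: after conjugation by a reflection that carries the first basis vector to an
    eigenvector, the first row is diagonal, and by symmetry so is the first column. *)
Theorem real_spectral (n : nat) (S : 'M[R]_n) : S^T = S ->
  exists (P : 'M[R]_n) (s : 'rV[R]_n), P *m P^T = 1%:M /\ P *m S *m P^T = diag_mx s.
Proof.
elim: n S => [|n IH] S SS.
  by exists 0, 0; split; apply/matrixP => -[].
have [p [mu [p1 pS]]] := exists_eigenvector SS.
have e1 : dot (delta_mx 0 0 : 'rV[R]_n.+1) (delta_mx 0 0) = 1.
  rewrite /dot (bigD1 0)//= big1 => [|i i0]; first by rewrite mxE eqxx mulr1 addr0.
  by rewrite mxE (negbTE i0) mulr0.
have [H [HH H1 eH]] := householder e1 p1.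
pose S' : 'M[R]_(1 + n) := H *m S *m H.
have S'T : S'^T = S' by rewrite /S' !trmx_mul HH SS mulmxA.
have S'0 j : S' 0 j = mu * (j == 0)%:R.
  have : delta_mx 0 0 *m S' = mu *: (delta_mx 0 0 : 'rV[R]_n.+1).
    rewrite /S' !mulmxA eH pS -scalemxAl -[in X in _ *: X]eH -mulmxA H1 mulmx1//.
  by rewrite -rowE => /rowP/(_ j); rewrite !mxE eqxx.
have S'E : S' = H *m S *m H by [].
clearbody S'.
have l0 : lshift n (0 : 'I_1) = 0 :> 'I_(1 + n) by exact: val_inj.
have ur : ursubmx S' = 0.
  by apply/matrixP => i j; rewrite (ord1 i) !mxE l0 S'0 mulr0.
have dl : dlsubmx S' = 0 by rewrite -[S']trmxK -trmx_ursub S'T ur trmx0.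
have ul : ulsubmx S' = mu%:M.
  by apply/matrixP => i j; rewrite !ord1 !mxE l0 S'0 !eqxx mulr1.
have [|P1 [s1 [PP PS]]] := IH (drsubmx S'); first by rewrite trmx_drsub S'T.
pose Q : 'M[R]_(1 + n) := block_mx 1%:M 0 0 P1.
have QQ : Q *m Q^T = 1%:M.
  rewrite /Q tr_block_mx mulmx_block !trmx0 trmx1 PP !mulmx0 !mul0mx mul1mx.
  by rewrite !addr0 add0r -scalar_mx_block.
have QSQ : Q *m S' *m Q^T = diag_mx (row_mx mu%:M s1).
  rewrite -[S']submxK ur dl ul /Q tr_block_mx !mulmx_block !trmx0 trmx1.
  rewrite !(mulmx0, mul0mx, mul1mx, mulmx1, addr0, add0r) PS.
  rewrite diag_mx_row; congr (block_mx _ _ _ _).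
  by apply/matrixP => i j; rewrite !ord1 !mxE eqxx.
exists (Q *m H), (row_mx mu%:M s1); split.
  rewrite trmx_mul HH mulmxA -[Q *m H *m H]mulmxA H1 mulmx1; exact: QQ.
rewrite trmx_mul HH !mulmxA (_ : Q *m H *m S *m H = Q *m S'); first exact: QSQ.
by rewrite S'E !mulmxA.
Qed.

End spectral.

Lemma gramE (K : comPzRingType) n m (M : 'M[K]_(n, m)) i j :
  (M *m M^T) i j = dot (row i M) (row j M).
Proof. by rewrite mxE; apply: eq_bigr => a _; rewrite !mxE. Qed.

(** With [A A^T = P^T diag(s) P], take [W = diag(1 + s)^(-1/2) P] and [l = sqrt s]. Diagonalizing
    [A A^T] is enough: the singular vectors on the target side enter only through the rows of
    [W A]. *)
Lemma normal_frame (R : realType) n m (A : 'M[R]_(n, m)) :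
  exists (W : 'M[R]_n) (l : 'I_n -> R),
  [/\ W *m (1%:M + A *m A^T) *m W^T = 1%:M,
      forall i j, i != j -> dot (row i (W *m A)) (row j (W *m A)) = 0,
      forall i, dot (row i (W *m A)) (row i (W *m A)) = l i ^+ 2 / (1 + l i ^+ 2) &
      \det (1%:M + A *m A^T) = \prod_i (1 + l i ^+ 2)].
Proof.
have [|P [s [PP PS]]] := @real_spectral R n (A *m A^T).
  by rewrite trmx_mul trmxK.
have s0 i : 0 <= s 0 i.
  have <- : (P *m A *m (P *m A)^T) i i = s 0 i.
    by rewrite trmx_mul mulmxA -[P *m A *m A^T]mulmxA PS mxE eqxx.
  by rewrite gramE dot_ge0.
pose r i := (Num.sqrt (1 + s 0 i))^-1.
have s1 i : 0 < 1 + s 0 i by have := s0 i; lra.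
have rr i : r i * r i = (1 + s 0 i)^-1 by rewrite -expr2 exprVn sqr_sqrtr// ltW.
pose D := diag_mx (\row_i r i).
have lE i : Num.sqrt (s 0 i) ^+ 2 = s 0 i by rewrite sqr_sqrtr.
have PgP : P *m (1%:M + A *m A^T) *m P^T = diag_mx (\row_i (1 + s 0 i)).
  rewrite mulmxDr mulmxDl mulmx1 PP PS; apply/matrixP => i j; rewrite !mxE.
  by case: eqP => [->|_]; rewrite ?mulr1n ?mulr0n ?addr0.
have DT : D^T = D by rewrite /D tr_diag_mx.
have DMD (d : 'rV[R]_n) i j : (D *m diag_mx d *m D) i j = (d 0 i / (1 + s 0 i)) *+ (i == j).
  rewrite /D mul_diag_mx mul_mx_diag !mxE -rr; case: eqP => [->|_]; last by rewrite !mulr0n mulr0 mul0r.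
  by rewrite !mulr1n; ring.
have cE i j : dot (row i (D *m P *m A)) (row j (D *m P *m A)) =
    (s 0 i / (1 + s 0 i)) *+ (i == j).
  rewrite -gramE -DMD -PS !trmx_mul DT !mulmxA; congr (fun_of_matrix (_ *m _) i j).
exists (D *m P), (fun i => Num.sqrt (s 0 i)); split.
- rewrite trmx_mul DT !mulmxA -[D *m P *m _]mulmxA -[D *m _ *m P^T]mulmxA PgP.
  apply/matrixP => i j; rewrite DMD !mxE; case: eqP => // _.
  by rewrite mulfV// gt_eqF.
- by move=> i j ij; rewrite cE (negbTE ij).
- by move=> i; rewrite cE eqxx lE.
- have detP : \det P * \det P^T = 1 by rewrite -det_mulmx PP det1.
  have /(congr1 determinant) := PgP; rewrite !det_mulmx det_diag mulrAC detP mul1r => ->.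
  by apply: eq_bigr => i _; rewrite mxE lE.
Qed.

(** The trace bound holds because [W W^T = 1 - (W A) (W A)^T]. *)
Lemma normal_frame_inverse (R : realType) n m (A : 'M[R]_(n, m)) (W : 'M[R]_n) :
  W *m (1%:M + A *m A^T) *m W^T = 1%:M ->
  [/\ W \in unitmx, 1%:M + A *m A^T \in unitmx,
      invmx (1%:M + A *m A^T) = W^T *m W & \tr (invmx (1%:M + A *m A^T)) <= n%:R].
Proof.
set g := 1%:M + _ => WgW.
have Wu : W \in unitmx by move: WgW; rewrite -mulmxA => /mulmx1_unit[].
have gE : g *m (W^T *m W) = 1%:M.
  apply: (can_inj (mulKmx Wu)); rewrite mulmx1 !mulmxA WgW mul1mx//.
have [gu _] := mulmx1_unit gE.
have gi : invmx g = W^T *m W by rewrite -[LHS]mulmx1 -gE mulKmx.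
split=> //; rewrite gi mxtrace_mulC.
have -> : W *m W^T = 1%:M - (W *m A) *m (W *m A)^T.
  by rewrite -WgW trmx_mul /g mulmxDr mulmxDl mulmx1 !mulmxA addrK.
rewrite linearB /= mxtrace1 gerBl; apply: sumr_ge0 => i _.
by rewrite gramE dot_ge0.
Qed.

(** * Derivatives of determinants *)

Section matrix_calculus.
Variables (R : realType) (V : normedModType R).

Definition Cn_mx (k : nat) n m (M : V -> 'M[R]_(n, m)) : Prop :=
  forall i j, Cn k (fun x => M x i j).

Definition dmx n m (w : V) (M : V -> 'M[R]_(n, m)) (x : V) : 'M[R]_(n, m) :=
  \matrix_(i, j) dd w (fun y => M y i j) x.

Lemma Cn_mxW k n m (M : V -> 'M[R]_(n, m)) : Cn_mx k.+1 M -> Cn_mx k M.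
Proof. by move=> Mk i j; exact: CnW. Qed.

Lemma Cn_dmx k n m (M : V -> 'M[R]_(n, m)) w : Cn_mx k.+1 M -> Cn_mx k (dmx w M).
Proof.
move=> Mk i j; rewrite (_ : (fun x => _) = dd w (fun y => M y i j)); first exact: Cn_dd.
by apply/funext => x; rewrite mxE.
Qed.

Lemma Cn_det k n (M : V -> 'M[R]_n) : Cn_mx k M -> Cn k (fun x => \det (M x)).
Proof.
move=> Mk; apply: Cn_sum => s; apply: CnZ; apply: Cn_prod => i; exact: Mk.
Qed.

Lemma Cn_adj k n (M : V -> 'M[R]_n) : Cn_mx k M -> Cn_mx k (fun x => \adj (M x)).
Proof.
move=> Mk i j; rewrite (_ : (fun x => _) = fun x => cofactor (M x) j i); last first.
  by apply/funext => x; rewrite mxE.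
apply: CnZ; apply: Cn_det => a b.
rewrite (_ : (fun x => _) = fun x => M x (lift j a) (lift i b)); first exact: Mk.
by apply/funext => x; rewrite !mxE.
Qed.

Lemma Cn_invmx k n (M : V -> 'M[R]_n) : Cn_mx k M -> (forall x, M x \in unitmx) ->
  Cn_mx k (fun x => invmx (M x)).
Proof.
move=> Mk Mu i j.
rewrite (_ : (fun x => _) = fun x => (\det (M x))^-1 * \adj (M x) i j); last first.
  by apply/funext => x; rewrite /invmx Mu mxE.
apply: CnM; last exact: Cn_adj.
by apply: CnV; [move=> x; rewrite -unitfE -unitmxE|exact: Cn_det].
Qed.

Lemma Cn_mulmx k n m p (M : V -> 'M[R]_(n, m)) (N : V -> 'M[R]_(m, p)) :
  Cn_mx k M -> Cn_mx k N -> Cn_mx k (fun x => M x *m N x).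
Proof.
move=> Mk Nk i j; rewrite (_ : (fun x => _) = fun x => \sum_l M x i l * N x l j).
  by apply: Cn_sum => l; apply: CnM.
by apply/funext => x; rewrite mxE.
Qed.

Lemma dmxM n m p (M : V -> 'M[R]_(n, m)) (N : V -> 'M[R]_(m, p)) w x :
  Cn_mx 1 M -> Cn_mx 1 N ->
  dmx w (fun y => M y *m N y) x = dmx w M x *m N x + M x *m dmx w N x.
Proof.
move=> M1 N1; apply/matrixP => i j; rewrite !mxE -big_split /=.
rewrite (_ : (fun y => (M y *m N y) i j) = fun y => \sum_l M y i l * N y l j); last first.
  by apply/funext => y; rewrite mxE.
rewrite (dd_sum _ _ _ (fun l => CnM (M1 i l) (N1 l j))); apply: eq_bigr => l _.
by rewrite (ddM _ (M1 i l) (N1 l j)) !mxE addrC [_ * N x l j]mulrC.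
Qed.

Lemma dd_trace k n (M : V -> 'M[R]_n) w : Cn_mx k.+1 M ->
  dd w (fun y => \tr (M y)) = fun x => \tr (dmx w M x).
Proof.
move=> Mk; rewrite /mxtrace (dd_sum _ _ _ (fun i => Mk i i)).
by apply/funext => x; apply: eq_bigr => i _; rewrite mxE.
Qed.

Lemma dd_prod (I : finType) (F : I -> V -> R) w x : (forall i, Cn 1 (F i)) ->
  dd w (fun y => \prod_i F i y) x = \sum_i dd w (F i) x * \prod_(j | j != i) F j x.
Proof.
move=> F1.
have H (r : seq I) : uniq r -> dd w (fun y => \prod_(i <- r) F i y) x =
    \sum_(i <- r) dd w (F i) x * \prod_(j <- r | j != i) F j x.
  elim: r => [_|i r IH /= /andP[ir ur]].
    rewrite (_ : (fun y => _) = fun=> 1); first by rewrite dd_cst big_nil.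
    by apply/funext => y; rewrite big_nil.
  rewrite (_ : (fun y => _) = fun y => F i y * \prod_(j <- r) F j y); last first.
    by apply/funext => y; rewrite big_cons.
  have Pr : Cn 1 (fun y => \prod_(j <- r) F j y) by exact: Cn_prod.
  rewrite (ddM _ (F1 i) Pr) IH// big_cons big_cons eqxx /= addrC; congr (_ + _).
    rewrite mulrC; congr (_ * _); rewrite big_seq_cond [RHS]big_seq_cond.
    by apply: eq_bigl => j; have [->|] := eqVneq j i; rewrite ?(negbTE ir).
  rewrite mulr_sumr big_seq_cond [RHS]big_seq_cond; apply: eq_bigr => j /andP[jr _].
  rewrite big_cons; case: eqP => [ij|_]; last by rewrite mulrCA.
  by rewrite ij jr in ir.
exact: (H _ (index_enum_uniq I)).
Qed.

(** Differentiating the permutation expansion replaces one row at a time by its derivative;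
    expanding [N i] along that row gives the cofactors. *)
Lemma jacobi_formula n (M : V -> 'M[R]_n) w x : Cn_mx 1 M ->
  dd w (fun y => \det (M y)) x = \tr (\adj (M x) *m dmx w M x).
Proof.
move=> M1.
pose N i : 'M[R]_n := \matrix_(k, j) if k == i then dmx w M x i j else M x k j.
have -> : \tr (\adj (M x) *m dmx w M x) = \sum_i \det (N i).
  rewrite mxtrace_mulC; apply: eq_bigr => i _; rewrite mxE (expand_det_row _ i).
  apply: eq_bigr => j _; rewrite [N i i j]mxE eqxx; congr (_ * _).
  rewrite mxE /cofactor; congr (_ * \det _); apply/matrixP => a b; rewrite !mxE.
  by rewrite eq_sym (negbTE (neq_lift _ _)).
rewrite /determinant.
have P1 (s : {perm 'I_n}) : Cn 1 (fun y => \prod_i M y i (s i)).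
  by apply: Cn_prod => i; exact: M1.
rewrite (@dd_sum _ _ 0 _ _ _ (fun (s : {perm 'I_n}) y => (-1) ^+ s * \prod_i M y i (s i))); last first.
  by move=> s; apply: CnZ; exact: P1.
rewrite exchange_big /=; apply: eq_bigr => s _.
rewrite (ddZ _ _ (P1 s)) (dd_prod _ _ (fun i => M1 i (s i))) mulr_sumr.
apply: eq_bigr => i _; congr (_ * _); rewrite [RHS](bigD1 i)//= [N i i _]mxE eqxx mxE.
by congr (_ * _); apply: eq_bigr => j ji; rewrite mxE (negbTE ji).
Qed.

(** Obtained by differentiating [M * adj M = det M * 1] at a point where both factors are the
    identity. *)
Lemma dmx_adj_at_id n (M : V -> 'M[R]_n) w x : Cn_mx 1 M -> M x = 1%:M ->
  dmx w (fun y => \adj (M y)) x = (\tr (dmx w M x))%:M - dmx w M x.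
Proof.
move=> M1 Mx.
have adj1 : \adj (1%:M : 'M[R]_n) = 1%:M by rewrite -[LHS]mul1mx mul_mx_adj det1.
have := dmxM w x M1 (Cn_adj M1).
rewrite Mx adj1 mulmx1 mul1mx => H; apply/eqP; rewrite eq_sym subr_eq addrC -H; apply/eqP.
apply/matrixP => i j; rewrite !mxE.
rewrite (_ : (fun y => _) = fun y => (i == j)%:R * \det (M y)); last first.
  by apply/funext => y; rewrite mul_mx_adj mxE mulr_natl.
by rewrite (ddZ _ _ (Cn_det M1)) jacobi_formula// Mx adj1 mul1mx mulr_natl.
Qed.

Lemma dd2_det_at_id n (M : V -> 'M[R]_n) w x : Cn_mx 2 M -> M x = 1%:M ->
  dd w (dd w (fun y => \det (M y))) x =
  \tr (dmx w M x) ^+ 2 - \tr (dmx w M x *m dmx w M x) + \tr (dmx w (dmx w M) x).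
Proof.
move=> M2 Mx; have M1 := Cn_mxW M2.
have adj1 : \adj (1%:M : 'M[R]_n) = 1%:M by rewrite -[LHS]mul1mx mul_mx_adj det1.
rewrite (_ : dd w (fun y => \det (M y)) = fun y => \tr (\adj (M y) *m dmx w M y)); last first.
  by apply/funext => y; exact: jacobi_formula.
have aM := Cn_mulmx (Cn_adj M1) (Cn_dmx w M2).
rewrite (dd_trace _ aM) (dmxM _ _ (Cn_adj M1) (Cn_dmx w M2)) dmx_adj_at_id//.
rewrite Mx adj1 mul1mx mulmxBl mul_scalar_mx linearD linearB /= linearZ /=.
by rewrite expr2.
Qed.

End matrix_calculus.

(** * Graphs *)

Lemma partial_entry (R : realType) n N (F : 'rV[R]_n -> 'rV[R]_N) i x j :
  (forall j, Cn 1 (fun y => F y 0 j)) ->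
  partial i F x 0 j = dd (delta_mx 0 i) (fun y => F y 0 j) x.
Proof.
move=> F1.
have Fd : derivable F x (delta_mx 0 i).
  apply/derivable_mxP => a b; rewrite (ord1 a); exact: Cn_derivable (F1 b).
rewrite /partial; have := derive_mx Fd; move=> ->; rewrite mxE.
by rewrite ddE_at.
Qed.

Section graph.
Variables (R : realType) (n m : nat) (u : 'rV[R]_n -> 'rV[R]_m).
Hypothesis u_smooth : smooth u.
Notation V := 'rV[R]_n.
Notation d i := (delta_mx 0 i : V).

Let uC k a : Cn k (fun x => u x 0 a). Proof. exact: smooth_Cn. Qed.

Definition jac (x : V) : 'M[R]_(n, m) := \matrix_(i, a) dd (d i) (fun y => u y 0 a) x.

Definition metric (x : V) : 'M[R]_n := 1%:M + jac x *m (jac x)^T.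

Lemma Cn_jac k : Cn_mx k jac.
Proof.
move=> i a; rewrite (_ : (fun x => _) = dd (d i) (fun y => u y 0 a)).
  by apply: Cn_dd; exact: uC.
by apply/funext => x; rewrite mxE.
Qed.

Lemma metric_unit x : metric x \in unitmx.
Proof.
have [W [l [WgW _ _ _]]] := normal_frame (jac x).
by have [] := normal_frame_inverse WgW.
Qed.

Lemma Cn_metric k : Cn_mx k metric.
Proof.
move=> i j.
rewrite (_ : (fun x => _) = fun x => (1%:M : 'M[R]_n) i j + (jac x *m (jac x)^T) i j).
  apply: CnD; first exact: Cn_cst.
  apply: (@Cn_mulmx _ _ k _ _ _ jac (fun x => (jac x)^T)); first exact: Cn_jac.
  move=> a b; rewrite (_ : (fun x => _) = fun x => jac x b a); first exact: Cn_jac.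
  by apply/funext => x; rewrite mxE.
by apply/funext => x; rewrite mxE.
Qed.

Lemma slope_metric x : slope u x = Num.sqrt (\det (metric x)).
Proof.
congr (Num.sqrt (\det _)); apply/matrixP => i j; rewrite !mxE; congr (_ + _).
by apply: eq_bigr => a _; rewrite !mxE !partial_entry.
Qed.

Let FC k j : Cn k (fun y => graph_map u y 0 j).
Proof.
case: (fintype.splitP j) => i ij.
  have -> : j = lshift m i by exact: val_inj.
  rewrite (_ : (fun y => _) = fun y : V => y 0 i); first exact: Cn_coord.
  by apply/funext => y; rewrite /graph_map row_mxEl.
have -> : j = rshift n i by exact: val_inj.
rewrite (_ : (fun y => _) = fun y : V => u y 0 i); first exact: uC.
by apply/funext => y; rewrite /graph_map row_mxEr.
Qed.

Let graph_l (i : 'I_n) : (fun y => graph_map u y 0 (lshift m i)) = fun y : V => y 0 i.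
Proof. by apply/funext => y; rewrite /graph_map row_mxEl. Qed.

Let graph_r (a : 'I_m) : (fun y => graph_map u y 0 (rshift n a)) = fun y : V => u y 0 a.
Proof. by apply/funext => y; rewrite /graph_map row_mxEr. Qed.

Lemma tangent_frame_graph x : tangent_frame (graph_map u) x = row_mx 1%:M (jac x).
Proof.
apply/matrixP => i j; rewrite mxE partial_entry//.
case: (fintype.splitP j) => k jk.
  have -> : j = lshift m k by exact: val_inj.
  by rewrite graph_l row_mxEl dd_coord !mxE eqxx eq_sym.
have -> : j = rshift n k by exact: val_inj.
by rewrite graph_r row_mxEr mxE.
Qed.

Lemma induced_metric_graph x : induced_metric (graph_map u) x = metric x.
Proof.
by rewrite /induced_metric tangent_frame_graph tr_row_mx mul_row_col trmx1 mulmx1.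
Qed.

Lemma partial2_graph i j x :
  partial i (partial j (graph_map u)) x =
  row_mx 0 (\row_a dd (d i) (dd (d j) (fun y => u y 0 a)) x).
Proof.
have E k : (fun y => partial j (graph_map u) y 0 k) = dd (d j) (fun y => graph_map u y 0 k).
  by apply/funext => y; rewrite partial_entry.
apply/rowP => k; rewrite partial_entry => [|l]; rewrite E; last first.
  by apply: Cn_dd; exact: FC.
case: (fintype.splitP k) => l kl.
  have -> : k = lshift m l by exact: val_inj.
  by rewrite graph_l row_mxEl dd_coord dd_cst mxE.
have -> : k = rshift n l by exact: val_inj.
by rewrite graph_r row_mxEr mxE.
Qed.

(** The projection in [normal_part] is meaningful because the kernel of [T^T] and the row space of
    [T] are complementary, which follows from the invertibility of [T T^T]. A vector without normal
    part is then tangent. *)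
Lemma normal_part_eq0 x (v : 'rV[R]_(n + m)) :
  normal_part (graph_map u) x v = 0 -> (v <= row_mx 1%:M (jac x))%MS.
Proof.
rewrite /normal_part tangent_frame_graph; set T := row_mx _ _; set K := kermx _.
have TT : T *m T^T = metric x.
  by rewrite tr_row_mx mul_row_col trmx1 mulmx1.
have KT : (K :&: <<T>> = 0)%MS.
  apply/eqP/rowV0P => w; rewrite sub_capmx => /andP[/sub_kermxP wK].
  rewrite genmxE => /submxP[c wc]; move: wK; rewrite wc -mulmxA TT => c0.
  by rewrite -[c](mulmxK (metric_unit x)) c0 !mul0mx.
have full : (v <= K + <<T>>)%MS.
  apply: submx_full; rewrite /row_full (mxrank_disjoint_sum KT) mxrank_ker mxrank_tr.
  by rewrite genmxE subnK// rank_leq_col.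
move=> vK; have := add_proj_mx KT full; rewrite vK add0r => <-.
by rewrite -(genmxE T); exact: proj_mx_sub.
Qed.

(** The vector [G^ij F_ij + F / 2] is tangent, hence of the form [c (1, Du)]. Since
    [F_ij = (0, u_ij)], the first block gives [c = x / 2], and the second block is the equation. *)
Lemma shrinker_equation x a : self_shrinker (graph_map u) ->
  \sum_i \sum_j invmx (metric x) i j * dd (d i) (dd (d j) (fun y => u y 0 a)) x =
  2^-1 * (dd x (fun y => u y 0 a) x - u x 0 a).
Proof.
move=> [_ /(_ x)]; rewrite /mean_curvature induced_metric_graph => H.
pose v := \sum_i \sum_j invmx (metric x) i j *: partial i (partial j (graph_map u)) x
  + 2^-1 *: graph_map u x.
have v0 : normal_part (graph_map u) x v = 0.
  rewrite /normal_part mulmxDl -scalemxAl -/(normal_part _ _ _).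
  apply/eqP; rewrite addr_eq0 -H; apply/eqP.
  rewrite /second_fundamental_form /normal_part mulmx_suml; apply: eq_bigr => i _.
  by rewrite mulmx_suml; apply: eq_bigr => j _; rewrite -scalemxAl.
have /submxP[c vc] := normal_part_eq0 v0.
have vE : v = row_mx (2^-1 *: x) (\row_b (\sum_i \sum_j invmx (metric x) i j *
    dd (d i) (dd (d j) (fun y => u y 0 b)) x + 2^-1 * u x 0 b)).
  apply/rowP => k; rewrite /v /graph_map mxE summxE.
  under eq_bigr do rewrite summxE.
  under eq_bigr do under eq_bigr do rewrite mxE partial2_graph.
  case: (fintype.splitP k) => l kl.
    have -> : k = lshift m l by exact: val_inj.
    rewrite row_mxEl [X in X + _]big1 => [|i _]; last first.
      by rewrite big1// => j _; rewrite row_mxEl mxE mulr0.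
    by rewrite add0r mxE row_mxEl mxE.
  have -> : k = rshift n l by exact: val_inj.
  rewrite [RHS]row_mxEr [RHS]mxE [X in _ + X = _]mxE row_mxEr; congr (_ + _).
  by apply: eq_bigr => i _; apply: eq_bigr => j _; rewrite row_mxEr mxE.
move: vc; rewrite vE mul_mx_row mulmx1 => /eq_row_mx[<-] /rowP/(_ a).
rewrite mxE -scalemxAl mxE => E.
have -> : dd x (fun y => u y 0 a) x = (x *m jac x) 0 a.
  rewrite (dd_partial _ _ (uC 1 a)) mxE; apply: eq_bigr => i _; by rewrite [jac x i a]mxE.
by rewrite mulrBr -E; ring.
Qed.

End graph.

Lemma dd2_sqr (R : realType) (V : normedModType R) (f : V -> R) w : Cn 2 f ->
  dd w (dd w (fun y => f y * f y)) =
  fun x => 2 * dd w f x ^+ 2 + 2 * f x * dd w (dd w f) x.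
Proof.
move=> f2; have f1 := CnW f2; have f'1 := Cn_dd w f2; have fM := CnM f1 f'1.
rewrite (ddM _ f2 f2) (ddD _ fM fM) (ddM _ f1 f'1).
by apply/funext => x; ring.
Qed.

Lemma mxtrace_mulmxE (R : comPzRingType) n (X Y : 'M[R]_n) :
  \tr (X *m Y) = \sum_a \sum_b X a b * Y b a.
Proof. by apply: eq_bigr => a _; rewrite mxE. Qed.

(* [M a] is the derivative in the direction [a] of the metric; the last sum
   comes from the differentiated self-shrinker equation. *)
Lemma second_variationE (R : realFieldType) n m (c : 'I_n -> 'rV[R]_m)
    (t : 'I_n -> 'I_n -> 'rV[R]_m) (M : 'I_n -> 'M[R]_n) :
  (forall i j, t i j = t j i) ->
  (forall a b e, M a b e = dot (t a e) (c b) + dot (t a b) (c e)) ->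
  \sum_a (\tr (M a) ^+ 2 - \tr (M a *m M a) + 2 * \sum_b dot (t a b) (t a b))
  + 2 * \sum_b \sum_p \sum_q M b p q * dot (t p q) (c b)
  = 2 * second_variation c t.
Proof.
move=> tC ME; rewrite /second_variation.
pose T i j k := dot (t j k) (c i).
have TC i j k : T i j k = T i k j by rewrite /T tC.
rewrite !big_split /= sumrN -mulr_sumr.
have E1 : \sum_a \tr (M a) ^+ 2 = 4 * \sum_k (\sum_i T i i k) ^+ 2.
  rewrite mulr_sumr; apply: eq_bigr => a _.
  have -> : \tr (M a) = 2 * \sum_i T i i a.
    by rewrite mulr_sumr; apply: eq_bigr => i _; rewrite ME -/(T i a i) TC; ring.
  by rewrite exprMn; ring.
pose S1 := \sum_k \sum_i \sum_j T k i j ^+ 2.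
pose S2 := \sum_i \sum_j \sum_k T i j k * T j i k.
have E2 : \sum_a \tr (M a *m M a) = 2 * S1 + 2 * S2.
  have -> : S1 = \sum_a \sum_b \sum_e T b a e ^+ 2.
    by rewrite /S1 exchange_big.
  have -> : S2 = \sum_a \sum_b \sum_e T b a e * T e a b.
    rewrite -(sum3_rot (fun a b e => T b a e * T e a b)).
    rewrite -(sum3_rot (fun a b e => T e b a * T a b e)).
    apply: eq_bigr => i _; apply: eq_bigr => j _; apply: eq_bigr => k _.
    by rewrite (TC i j) (TC j i).
  have Sw : \sum_a \sum_b \sum_e T e a b ^+ 2 = \sum_a \sum_b \sum_e T b a e ^+ 2.
    by apply: eq_bigr => a _; exact: exchange_big.
  rewrite [X in X + _](_ : _ = \sum_a \sum_b \sum_e T b a e ^+ 2 +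
    \sum_a \sum_b \sum_e T e a b ^+ 2); last by rewrite Sw; ring.
  rewrite mulr_sumr -!big_split /=.
  apply: eq_bigr => a _; rewrite mxtrace_mulmxE mulr_sumr -!big_split /=.
  apply: eq_bigr => b _; rewrite mulr_sumr -!big_split /=.
  apply: eq_bigr => e _; rewrite !ME -!/(T _ _ _); ring.
have E3 : \sum_b \sum_p \sum_q M b p q * dot (t p q) (c b) = 2 * S2.
  have Sw : \sum_b \sum_p \sum_q T q b p * T b p q = S2.
    rewrite /S2; apply: eq_bigr => b _; rewrite exchange_big /=.
    by apply: eq_bigr => q _; apply: eq_bigr => p _; rewrite mulrC (TC b).
  rewrite [RHS](_ : _ = \sum_b \sum_p \sum_q T q b p * T b p q + S2); last first.
    by rewrite Sw; ring.
  rewrite /S2 -!big_split /=; apply: eq_bigr => b _.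
  rewrite -!big_split /=; apply: eq_bigr => p _; rewrite -!big_split /=.
  apply: eq_bigr => q _; rewrite ME -!/(T _ _ _); ring.
rewrite E1 E2 E3; have -> : \sum_k \sum_i \sum_j dot (t i j) (c k) ^+ 2 = S1 by [].
have -> : \sum_i \sum_j \sum_k dot (t j k) (c i) * dot (t i k) (c j) = S2 by [].
have -> : \sum_k (\sum_i dot (t i k) (c i)) ^+ 2 = \sum_k (\sum_i T i i k) ^+ 2 by [].
ring.
Qed.

Lemma dd_row_mulmx (R : realType) n (W : 'M[R]_n) (f : 'rV[R]_n -> R) b x : Cn 1 f ->
  dd (row b W) f x = \sum_i W b i * dd (delta_mx 0 i) f x.
Proof. by move=> f1; rewrite dd_partial//; apply: eq_bigr => i _; rewrite mxE. Qed.

Definition hessian (R : realType) n (f : 'rV[R]_n -> R) (x : 'rV[R]_n) : 'M[R]_n :=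
  \matrix_(i, j) dd (delta_mx 0 i) (dd (delta_mx 0 j) f) x.

Lemma hessian_frame (R : realType) n (W : 'M[R]_n) (f : 'rV[R]_n -> R) x a b : Cn 2 f ->
  (W *m hessian f x *m W^T) a b = dd (row a W) (dd (row b W) f) x.
Proof.
move=> f2; have f'1 w := Cn_dd w f2.
rewrite dd_row_mulmx// mxE.
transitivity (\sum_j \sum_i W a i * (W b j * dd (delta_mx 0 i) (dd (delta_mx 0 j) f) x)).
  apply: eq_bigr => j _; rewrite !mxE mulr_suml; apply: eq_bigr => i _.
  by rewrite mxE; ring.
rewrite exchange_big /=; apply: eq_bigr => i _; rewrite -mulr_sumr; congr (_ * _).
rewrite dd_comm// dd_row_mulmx//; apply: eq_bigr => j _; by rewrite dd_comm.
Qed.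

(** * The drift Laplacian of [det g] *)

Section shrinker.
Variables (R : realType) (n m : nat) (u : 'rV[R]_n -> 'rV[R]_m).
Hypothesis u_smooth : smooth u.
Hypothesis u_shrinker : self_shrinker (graph_map u).
Notation V := 'rV[R]_n.
Notation L := (drift_laplacian (fun x => invmx (metric u x))).

Let uC k a : Cn k (fun x => u x 0 a). Proof. exact: smooth_Cn. Qed.

Variables (x0 : V) (W : 'M[R]_n).
Hypothesis WgW : W *m metric u x0 *m W^T = 1%:M.

Let e a : V := row a W.

Let Wu : W \in unitmx.
Proof. by have [] := normal_frame_inverse WgW. Qed.

Let c b a (x : V) : R := dd (e b) (fun y => u y 0 a) x.

Let cC k b a : Cn k (c b a). Proof. by apply: Cn_dd; exact: uC. Qed.

(** The metric in the constant frame [W], which is known to be orthonormal only at [x0]; its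
    determinant is [det g] times the constant [(det W)^2]. *)
Let M (x : V) : 'M[R]_n := W *m metric u x *m W^T.

Let cE b a x : c b a x = (W *m jac u x) b a.
Proof. by rewrite /c dd_row_mulmx// mxE; apply: eq_bigr => i _; rewrite mxE. Qed.

Let ME x a b : M x a b = (W *m W^T) a b + \sum_k c a k x * c b k x.
Proof.
rewrite /M /metric mulmxDr mulmxDl mulmx1 mxE; congr (_ + _).
rewrite -mulmxA -mulmxA -trmx_mul mulmxA mxE; apply: eq_bigr => k _.
by rewrite !cE; congr (_ * _); exact: mxE.
Qed.

Let MC k : Cn_mx k M.
Proof.
move=> a b; rewrite (_ : (fun x => _) = fun x => (W *m W^T) a b + \sum_k c a k x * c b k x).
  by apply: CnD; [exact: Cn_cst|apply: Cn_sum => i; exact: CnM].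
by apply/funext => x; exact: ME.
Qed.

Let t a b : 'rV[R]_m := \row_k dd (e a) (c b k) x0.

Let tC a b : t a b = t b a.
Proof. by apply/rowP => k; rewrite !mxE /c dd_comm. Qed.

Let c0 b : 'rV[R]_m := row b (W *m jac u x0).

Let tE a b k : t a b 0 k = dd (e a) (c b k) x0. Proof. by rewrite mxE. Qed.

Let c0E b k : c0 b 0 k = c b k x0. Proof. by rewrite mxE cE. Qed.

Let dM w x a b : dmx w M x a b = \sum_k (c a k x * dd w (c b k) x + c b k x * dd w (c a k) x).
Proof.
rewrite mxE (_ : (fun y => M y a b) = fun x => (W *m W^T) a b + \sum_k c a k x * c b k x).
  have H k := CnM (cC 1 a k) (cC 1 b k).
  rewrite (ddD _ (Cn_cst _ 1 _) (Cn_sum _ _ H)) dd_cst add0r (dd_sum _ _ _ H).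
  by apply: eq_bigr => k _; rewrite (ddM _ (cC 1 a k) (cC 1 b k)).
by apply/funext => y; exact: ME.
Qed.

Let dM0 a b b' : dmx (e a) M x0 b b' = dot (t a b') (c0 b) + dot (t a b) (c0 b').
Proof.
rewrite dM /dot -big_split /=; apply: eq_bigr => k _.
by rewrite !tE !c0E; congr (_ + _); rewrite mulrC.
Qed.

Let M_unit y : M y \in unitmx.
Proof. by rewrite /M !unitmx_mul Wu metric_unit unitmx_tr. Qed.

(* Multiplying by the determinant replaces the inverse of [M y] by its adjugate,
   which is easier to differentiate. *)
Let shrinker_frame k y :
  \sum_a \sum_b \adj (M y) a b * dd (e a) (c b k) y =
  \det (M y) * (2^-1 * (\sum_i y 0 i * dd (delta_mx 0 i) (fun z => u z 0 k) y - u y 0 k)).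
Proof.
rewrite -(dd_partial y y (uC 1 k)) -(shrinker_equation u_smooth _ _ u_shrinker).
have adjE : \adj (M y) = \det (M y) *: invmx (M y).
  rewrite /invmx M_unit scalerA mulfV ?scale1r//.
  by rewrite -unitfE -unitmxE.
rewrite adjE.
transitivity (\det (M y) * \sum_a \sum_b invmx (M y) a b * dd (e a) (c b k) y).
  rewrite mulr_sumr; apply: eq_bigr => a _; rewrite mulr_sumr; apply: eq_bigr => b _.
  by rewrite mxE mulrA.
congr (_ * _); pose f z := u z 0 k; have f2 : Cn 2 f by exact: uC.
have cm v w : dd v (dd w f) y = dd w (dd v f) y.
  by rewrite (@dd_comm _ _ f w v).
have HT : (hessian f y)^T = hessian f y.
  by apply/matrixP => i j; rewrite !mxE cm.
transitivity (\tr (invmx (M y) *m (W *m hessian f y *m W^T))).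
  rewrite mxtrace_mulmxE; apply: eq_bigr => a _; apply: eq_bigr => b _.
  by rewrite hessian_frame// cm.
transitivity (\tr (invmx (metric u y) *m hessian f y)); last first.
  rewrite mxtrace_mulmxE; apply: eq_bigr => i _; apply: eq_bigr => j _.
  by rewrite [hessian f y j i]mxE cm.
have -> : invmx (M y) = invmx W^T *m invmx (metric u y) *m invmx W.
  apply: (can_inj (mulKmx (M_unit y))); rewrite mulmxV// /M !mulmxA.
  by rewrite mulmxK ?unitmx_tr// mulmxK ?metric_unit// mulmxV.
rewrite -!mulmxA mxtrace_mulC -!mulmxA mulmxV ?unitmx_tr// mulmx1.
by rewrite [invmx W *m _]mulmxA mulVmx// mul1mx.
Qed.

(* The previous equation differentiated in the direction [e p] at [x0], where
   [M x0 = 1]. *)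
Let shrinker_derivative p k :
  \sum_a dd (e a) (dd (e a) (c p k)) x0 - 2^-1 * dd x0 (c p k) x0 =
  \sum_a \sum_b dmx (e p) M x0 a b * t a b 0 k.
Proof.
pose f := fun z => u z 0 k.
have adj1 : \adj (1%:M : 'M[R]_n) = 1%:M by rewrite -[LHS]mul1mx mul_mx_adj det1.
have hC a b : Cn 1 (dd (e a) (c b k)) by exact: Cn_dd (cC 2 b k).
have aC := Cn_adj (MC 1).
have H1 a b := CnM (aC a b) (hC a b).
have H2 i := CnM (Cn_coord R 1 i) (Cn_dd (delta_mx 0 i) (uC 2 k)).
have fC : Cn 1 f by exact: uC.
have E0 := shrinker_frame k x0.
have Mx0 : M x0 = 1%:M := WgW.
rewrite Mx0 adj1 det1 mul1r in E0.
have S1 (X : 'I_n -> 'I_n -> R) : \sum_a \sum_b (1%:M : 'M[R]_n) a b * X a b = \sum_a X a a.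
  apply: eq_bigr => a _; rewrite (bigD1 a)//= big1 ?addr0 => [|b ba]; rewrite mxE.
    by rewrite eqxx mul1r.
  by rewrite eq_sym (negbTE ba) mul0r.
rewrite S1 in E0.
have := congr1 (fun F => dd (e p) F x0) (funext (shrinker_frame k)).
rewrite (dd_sum _ _ _ (fun a => Cn_sum _ _ (H1 a))).
under eq_bigr => a _.
  rewrite (dd_sum _ _ _ (H1 a)).
  under eq_bigr => b _.
    rewrite (ddM _ (aC a b) (hC a b)) Mx0 adj1.
    over.
  rewrite big_split /=.
  over.
rewrite big_split /= S1.
have D1 : dd (e p) (fun y => \det (M y)) x0 = \tr (dmx (e p) M x0).
  by rewrite jacobi_formula ?Mx0 ?adj1 ?mul1mx//; exact: MC.
have HB := CnB (Cn_sum (index_enum 'I_n) xpredT H2) fC.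
rewrite (ddM _ (Cn_det (MC 1)) (CnZ 2^-1 HB)) D1 Mx0 det1 mul1r -E0.
rewrite (ddZ _ _ HB) (ddB _ (Cn_sum _ _ H2) fC) (dd_sum _ _ _ H2).
(* Differentiating the factor [y] in [y.Du] gives [dd (e p) f], which cancels the derivative of
   [- u]; no term of order zero survives. *)
have E3 : \sum_i dd (e p) (fun y : V => y 0 i * dd (delta_mx 0 i) f y) x0 - dd (e p) f x0 =
    dd x0 (c p k) x0.
  rewrite (dd_partial x0 x0 (cC 1 p k)) [X in _ - X](dd_partial _ _ fC) -sumrB.
  apply: eq_bigr => i _; rewrite (ddM _ (Cn_coord R 1 i) (Cn_dd (delta_mx 0 i) (uC 2 k))).
  by rewrite dd_coord /c dd_comm// [_ * e p 0 i]mulrC addrK.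
rewrite E3.
(* The trace part of the derivative of the adjugate cancels against the derivative of [\det (M y)],
   by the equation [E0] at [x0]. *)
have E4 : \sum_a \sum_b dd (e a) (c b k) x0 * dd (e p) (fun y => \adj (M y) a b) x0 =
    \tr (dmx (e p) M x0) * \sum_a dd (e a) (c a k) x0
    - \sum_a \sum_b dmx (e p) M x0 a b * t a b 0 k.
  transitivity (\sum_a \sum_b (dmx (e p) (fun y => \adj (M y)) x0 a b) * t a b 0 k).
    by apply: eq_bigr => a _; apply: eq_bigr => b _; rewrite mulrC tE mxE.
  rewrite (dmx_adj_at_id _ (MC 1) Mx0) mulr_sumr.
  rewrite -(S1 (fun a b => \tr (dmx (e p) M x0) * dd (e a) (c b k) x0)) -sumrB.
  apply: eq_bigr => a _; rewrite -sumrB; apply: eq_bigr => b _.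
  rewrite tE -scalemx1; set z := dd _ _ x0; set D := dmx _ _ _.
  by clearbody z D; rewrite !mxE; ring.
rewrite E4.
have -> : \sum_a dd (e p) (dd (e a) (c a k)) x0 = \sum_a dd (e a) (dd (e a) (c p k)) x0.
  apply: eq_bigr => a _; rewrite dd_comm; last exact: cC.
  by congr (dd _ _ x0); rewrite /c dd_comm.
move: (\sum_a _) (\tr _) (\sum_a _) (\sum_a _) (dd _ _ _) => X1 X2 X3 X4 X5 EE.
lra.
Qed.

(** Third derivatives of [u] enter only through the pairing of [c] with its own drift Laplacian, the
    drift term included; [shrinker_derivative] replaces it by products of first and second
    derivatives. *)
Lemma drift_laplacian_det_metric :
  \det W ^+ 2 * L (fun x => \det (metric u x)) x0 = 2 * second_variation c0 t.
Proof.
have [_ _ GE _] := normal_frame_inverse WgW.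
rewrite -drift_laplacianZ; last by apply: Cn_det; exact: Cn_metric.
rewrite (_ : (fun y => _) = fun y => \det (M y)); last first.
  by apply/funext => y; rewrite /M !det_mulmx det_tr; ring.
rewrite (drift_laplacian_frame (Cn_det (MC 2)) GE) -(second_variationE tC dM0).
have Mx0 : M x0 = 1%:M := WgW.
have adj1 : \adj (1%:M : 'M[R]_n) = 1%:M by rewrite -[LHS]mul1mx mul_mx_adj det1.
have E1 a : dd (e a) (dd (e a) (fun y => \det (M y))) x0 =
  \tr (dmx (e a) M x0) ^+ 2 - \tr (dmx (e a) M x0 *m dmx (e a) M x0)
  + 2 * \sum_b dot (t a b) (t a b)
  + 2 * \sum_b \sum_k c b k x0 * dd (e a) (dd (e a) (c b k)) x0.
  rewrite (dd2_det_at_id _ (MC 2) Mx0) -[RHS]addrA; congr (_ + _).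
  rewrite !mulr_sumr -big_split /=; apply: eq_bigr => b _.
  rewrite mxE (_ : (fun y => _) = dd (e a) (fun y => \sum_k c b k y * c b k y)); last first.
    have H k := CnM (cC 1 b k) (cC 1 b k).
    apply/funext => y; rewrite dM (dd_sum _ _ _ H); apply: eq_bigr => k _.
    by rewrite (ddM _ (cC 1 b k) (cC 1 b k)).
  have H k := CnM (cC 2 b k) (cC 2 b k).
  rewrite (dd_sum _ _ _ H) (dd_sum _ _ _ (fun k => Cn_dd (e a) (H k))).
  rewrite !mulr_sumr -big_split /=; apply: eq_bigr => k _.
  by rewrite (dd2_sqr _ (cC 2 b k)) tE; ring.
rewrite (eq_bigr _ (fun a _ => E1 a)) big_split /= -addrA; congr (_ + _).
have -> : dd x0 (fun y => \det (M y)) x0 = 2 * \sum_b \sum_k c b k x0 * dd x0 (c b k) x0.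
  rewrite jacobi_formula ?Mx0 ?adj1 ?mul1mx//.
  rewrite mulr_sumr; apply: eq_bigr => b _; rewrite dM mulr_sumr; apply: eq_bigr => k _.
  by ring.
have -> : \sum_b \sum_p \sum_q dmx (e b) M x0 p q * dot (t p q) (c0 b) =
    \sum_b \sum_k c b k x0 *
      (\sum_a dd (e a) (dd (e a) (c b k)) x0 - 2^-1 * dd x0 (c b k) x0).
  apply: eq_bigr => b _.
  transitivity (\sum_k c b k x0 * \sum_p \sum_q dmx (e b) M x0 p q * t p q 0 k); last first.
    by apply: eq_bigr => k _; rewrite shrinker_derivative.
  under [RHS]eq_bigr do rewrite mulr_sumr.
  rewrite [RHS]exchange_big /=; apply: eq_bigr => p _.
  under [RHS]eq_bigr do rewrite mulr_sumr.
  rewrite [RHS]exchange_big /=; apply: eq_bigr => q _.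
  rewrite /dot mulr_sumr; apply: eq_bigr => k _.
  by rewrite c0E; ring.
rewrite -mulr_sumr.
have -> : \sum_b \sum_k c b k x0 *
      (\sum_a dd (e a) (dd (e a) (c b k)) x0 - 2^-1 * dd x0 (c b k) x0) =
    \sum_a \sum_b \sum_k c b k x0 * dd (e a) (dd (e a) (c b k)) x0 -
    2^-1 * \sum_b \sum_k c b k x0 * dd x0 (c b k) x0.
  rewrite [X in _ = X - _]exchange_big /= mulr_sumr -sumrB; apply: eq_bigr => b _.
  rewrite [X in _ = X - _]exchange_big /= mulr_sumr -sumrB; apply: eq_bigr => k _.
  by rewrite -mulr_sumr; ring.
ring.
Qed.

End shrinker.

(** * Vanishing of the Hessian and linearity of [u] *)

Section rigidity.
Variables (R : realType) (n m : nat) (u : 'rV[R]_n -> 'rV[R]_m).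
Hypothesis u_smooth : smooth u.
Hypothesis u_shrinker : self_shrinker (graph_map u).
Hypothesis slope_lt3 : forall x, slope u x < 3.
Notation V := 'rV[R]_n.
Notation G := (fun x => invmx (metric u x)).
Notation L := (drift_laplacian G).

Let f (x : V) : R := \det (metric u x).

Let f2 : Cn 2 f. Proof. by apply: Cn_det; exact: Cn_metric. Qed.

Let det_lt9 x : f x < 9.
Proof.
have [_ [l [_ _ _ dE]]] := normal_frame (jac u x).
have f0 : 0 <= f x.
  by rewrite /f /metric dE; apply: prodr_ge0 => i _; rewrite addr_ge0 ?sqr_ge0.
have := slope_lt3 x; rewrite slope_metric// -/(f x) => s3.
rewrite -(sqr_sqrtr f0) (_ : 9 = 3 ^+ 2); last by ring.
by rewrite ltr_pXn2r// ?nnegrE ?sqrtr_ge0.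
Qed.

Lemma drift_laplacian_det_ge0 x : 0 <= L f x /\
  (L f x = 0 -> forall a, hessian (fun y => u y 0 a) x = 0).
Proof.
have uC k a : Cn k (fun x => u x 0 a) by exact: smooth_Cn.
have [W [l [WgW orth norm dE]]] := normal_frame (jac u x).
have [Wu _ _ _] := normal_frame_inverse WgW.
have E := drift_laplacian_det_metric u_smooth u_shrinker WgW.
set t := (X in second_variation _ X) in E.
have [|a b|sv0 sv_eq0] := @second_variation_ge0 R n m _ l orth norm _ t.
- by rewrite -dE; exact: det_lt9.
- by apply/rowP => k; rewrite !mxE dd_comm.
have W2 : 0 < \det W ^+ 2.
  by rewrite lt_neqAle sqr_ge0 andbT eq_sym sqrf_eq0 -unitfE -unitmxE.
split=> [|L0 a]; first by rewrite -(pmulr_rge0 _ W2) E mulr_ge0.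
have t0 : forall i j, t i j = 0.
  apply: sv_eq0; apply/eqP; move/eqP: E; rewrite L0 mulr0 eq_sym mulf_eq0.
  by rewrite pnatr_eq0.
have : W *m hessian (fun y => u y 0 a) x *m W^T = 0.
  apply/matrixP => i j; rewrite hessian_frame//; have /rowP/(_ a) := t0 i j.
  by rewrite !mxE.
move=> /(congr1 (fun X => invmx W *m X *m invmx W^T)).
by rewrite /= -!mulmxA mulKmx// mulmxV ?unitmx_tr// mulmx1 mul0mx mulmx0.
Qed.

Lemma hessian_eq0 a x : hessian (fun y => u y 0 a) x = 0.
Proof.
apply: (drift_laplacian_det_ge0 x).2.
have Gg y : exists2 W : 'M[R]_n, W \in unitmx & G y = W^T *m W.
  have [W [l [WgW _ _ _]]] := normal_frame (jac u y).
  by have [Wu _ GE _] := normal_frame_inverse WgW; exists W.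
have Gt y : \tr (G y) <= n%:R.
  have [W [l [WgW _ _ _]]] := normal_frame (jac u y).
  by have [] := normal_frame_inverse WgW.
have Gc i j : continuous (fun y => G y i j).
  apply: (@Cn_continuous _ _ 0).
  by apply: Cn_invmx => [|y]; [exact: Cn_metric|exact: metric_unit].
have fc := liouville Gc Gg Gt f2 (fun y => (drift_laplacian_det_ge0 y).1)
  (fun y => ltW (det_lt9 y)).
rewrite (_ : f = fun=> f 0); last by apply/funext => y; exact: fc.
rewrite /drift_laplacian dd_cst mulr0 subr0 big1// => i _; rewrite big1// => j _.
by rewrite !dd_cst mulr0.
Qed.

Lemma graph_linear x : u x = x *m jac u 0.
Proof.
have uC k a : Cn k (fun x => u x 0 a) by exact: smooth_Cn.
have hess0 a i j y : dd (delta_mx 0 i) (dd (delta_mx 0 j) (fun z => u z 0 a)) y = 0.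
  by have /matrixP/(_ i j) := hessian_eq0 a y; rewrite !mxE.
apply/rowP => a.
have := shrinker_equation u_smooth x a u_shrinker.
rewrite big1 => [|i _]; last by rewrite big1// => j _; rewrite hess0 mulr0.
move=> /esym/eqP; rewrite mulf_eq0 invr_eq0 pnatr_eq0 /= subr_eq0 => /eqP <-.
rewrite (dd_partial _ _ (uC 1 a)) mxE; apply: eq_bigr => i _; congr (_ * _).
rewrite mxE; set g := dd _ _.
have g1 : Cn 1 g by apply: Cn_dd; exact: uC.
have [y|c _] := @MVT_line R _ g 0 x; first exact: Cn_derivable g1.
rewrite add0r -ddE_at (dd_partial _ _ g1) big1 => [/eqP|j _]; last by rewrite hess0 mulr0.
by rewrite subr_eq0 => /eqP.
Qed.

End rigidity.

Unset Implicit Arguments.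
Set Strict Implicit.

Theorem theorem4p1 (R : realType) (n m : nat) (u : 'rV[R]_n -> 'rV[R]_m)
  (u_smooth : smooth u)
  (M_shrinker : self_shrinker (graph_map u))
  (slope_lt3 : forall x : 'rV[R]_n, slope u x < 3) :
  linear u /\ linear_subspace (range (graph_map u)).
Proof.
have uE := @graph_linear R n m u u_smooth M_shrinker slope_lt3.
split; first by move=> k x y; rewrite !uE mulmxDl scalemxAl.
pose h := linfun (mulmxr (row_mx 1%:M (jac u 0))) : 'Hom('rV[R]_n, 'rV[R]_(n + m)).
have hE x : h x = graph_map u x.
  by rewrite lfunE /= mul_mx_row mulmx1 /graph_map uE.
exists (limg h); apply/seteqP; split => [_ [x _ <-]|X /= /memv_imgP[x _ ->]].
  by rewrite /= -hE; apply: memv_img; exact: memvf.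
by exists x.
Qed.
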